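(* Let $F$ be a locally indicable group and let $T$ be an $F$-tree with trivial edge stabilizers. If $r$ is an element of $F$ that fixes no vertex of $T$, then $\mathbf{C}_F(r)$ is infinite and cyclic, and $r$ is Cohen-Lyndon aspherical in $F$.
   Context: A group is indicable if it is trivial or has some quotient that is infinite and cyclic; a group is locally indicable if all its finitely generable subgroups are indicable. An $F$-tree is a tree $T$ with vertex set $VT$, edge set $ET$ and incidence maps $\iota,\tau\colon ET\to VT$ (initial and terminal vertices), on which $F$ acts on the left by automorphisms commuting with $\iota$ and $\tau$ (so there are no edge inversions). For $x,y\in F$, ${}^{x}y:=xyx^{-1}$, and $\mathbf{C}_F(x)=\{f\in F\mid {}^{f}x=x\}$; for subsets $X,R\subseteq F$, ${}^{X}R:=\{{}^{x}r\mid x\in X, r\in R\}$, and $\langle R\rangle$ is the subgroup generated by $R$. For a single element $r$, ${}^{F}r:={}^{F}\{r\}$. A subset $X$ of a group $H$ is a free-generating set of $H$ if $H$ is free with basis $X$. A subset $Y$ of a group $H$ is a Whitehead subset of $H$ if there exists a free-generating set $X$ of $H$ with ${}^{H}X=Y$. An element $r$ of $F$ is Cohen-Lyndon aspherical in $F$ if ${}^{F}r$ is a Whitehead subset of $\langle {}^{F}r\rangle$. *)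

(* Defs.v *)
From HB Require Import structures.
From mathcomp Require Import all_boot.
From mathcomp Require Import mathcomp_extra boolp classical_sets functions.
From mathcomp Require Import cardinality.

Set Implicit Arguments.
Unset Strict Implicit.
Unset Printing Implicit Defensive.

Local Open Scope classical_set_scope.
Local Open Scope group_scope.

Definition is_subgroup (G : groupType) (A : set G) : Prop :=
  A 1 /\ forall x y, A x -> A y -> A (x / y).

Record subgroup (G : groupType) := Subgroup {
  subgroup_set : set G;
  subgroupP : is_subgroup subgroup_set
}.

Section SubgroupGroup.
Variables (G : groupType) (H : subgroup G).

Record subgroup_elt := SubgroupElt {
  subgroup_val :> G;
  _ : subgroup_val \in subgroup_set H
}.

HB.instance Definition _ := [isSub for subgroup_val].
HB.instance Definition _ := [Choice of subgroup_elt by <:].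

Fact subgroup_closed : group_closed (mem (subgroup_set H)).
Proof.
have [H1 HF] := subgroupP H.
split; first by apply/mem_set.
by move=> x y /set_mem Hx /set_mem Hy; apply/mem_set/HF.
Qed.

HB.instance Definition _ :=
  SubChoice_isSubGroup.Build G _ subgroup_elt subgroup_closed.

End SubgroupGroup.

Coercion subgroup_group (G : groupType) (H : subgroup G) : groupType :=
  subgroup_elt H.

Definition generated (G : groupType) (R : set G) : set G :=
  smallest (@is_subgroup G) R.

Lemma is_subgroup_generated (G : groupType) (R : set G) :
  is_subgroup (generated R).
Proof.
split=> [A [[A1 _] _] //|x y Rx Ry A AP].
by have [_ AF] := AP.1; apply: AF; [apply: Rx|apply: Ry].
Qed.

Definition generated_subgroup (G : groupType) (R : set G) : subgroup G :=
  Subgroup (is_subgroup_generated R).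

(* The left conjugate [x y x^-1]; the library's [y ^ x] is [x^-1 y x]. *)
Definition lconjg (G : groupType) (x y : G) : G := x * y * x^-1.

Definition lconj_set (G : groupType) (X R : set G) : set G :=
  [set lconjg x r | x in X & r in R].

Lemma is_subgroup_centralizer (G : groupType) (x : G) :
  is_subgroup [set f : G | lconjg f x = x].
Proof.
rewrite /lconjg; split=> /= [|f g fx gx].
  by rewrite invg1 mul1g mulg1.
rewrite invgF (_ : _ * _ = f * (g^-1 * x * g) * f^-1); last by rewrite !mulgA.
by rewrite -[X in g^-1 * X]gx !mulgA !mulgVK.
Qed.

Definition centralizer (G : groupType) (x : G) : subgroup G :=
  Subgroup (is_subgroup_centralizer x).

Definition infinite_cyclic (G : groupType) : Prop :=
  infinite_set [set: G] /\ exists g : G, generated [set g] = [set: G].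

Definition finitely_generable (G : groupType) : Prop :=
  exists S : set G, finite_set S /\ generated S = [set: G].

(* The quotients of [G] are taken to be its homomorphic images. *)
Definition indicable (G : groupType) : Prop :=
  [set: G] = [set 1] \/
  exists (Q : groupType) (q : {multiplicative G -> Q}),
    range q = [set: Q] /\ infinite_cyclic Q.

Definition locally_indicable (G : groupType) : Prop :=
  forall H : subgroup G, finitely_generable H -> indicable H.

(* The universal property of a basis; the values of [f] outside [X] are
   irrelevant. *)
Definition free_generating (G : groupType) (X : set G) : Prop :=
  forall (K : groupType) (f : G -> K),
    exists phi : {multiplicative G -> K},
      (forall x, X x -> phi x = f x) /\
      forall psi : {multiplicative G -> K},
        (forall x, X x -> psi x = f x) -> psi =1 phi.

Definition Whitehead_subset (G : groupType) (Y : set G) : Prop :=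
  exists X : set G, free_generating X /\ lconj_set setT X = Y.

(* The set [^F r] is viewed inside the group [<^F r>] by taking its preimage
   under the inclusion [val]. *)
Definition Cohen_Lyndon_aspherical (F : groupType) (r : F) : Prop :=
  let Y := lconj_set setT [set r] in
  Whitehead_subset ((val : generated_subgroup Y -> F) @^-1` Y).

Record graph := Graph {
  vertex : Type;
  edge : Type;
  initial : edge -> vertex;
  terminal : edge -> vertex
}.

Section Paths.
Variable T : graph.

(* [(e, true)] traverses [e] from its initial to its terminal vertex, and
   [(e, false)] traverses it backwards. *)
Definition dart : Type := edge T * bool.

Definition dart_source (d : dart) : vertex T :=
  if d.2 then initial d.1 else terminal d.1.

Definition dart_target (d : dart) : vertex T :=
  if d.2 then terminal d.1 else initial d.1.

Definition dart_inv (d : dart) : dart := (d.1, ~~ d.2).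

Fixpoint is_path (v : vertex T) (p : seq dart) (w : vertex T) : Prop :=
  match p with
  | [::] => v = w
  | d :: p' => dart_source d = v /\ is_path (dart_target d) p' w
  end.

Fixpoint reduced (p : seq dart) : Prop :=
  match p with
  | d1 :: ((d2 :: _) as p') => d2 <> dart_inv d1 /\ reduced p'
  | _ => True
  end.

(* An empty tree is excluded: every element of a group acting on it would
   vacuously fix no vertex. *)
Definition is_tree : Prop :=
  inhabited (vertex T) /\
  forall v w : vertex T, exists! p : seq dart, is_path v p w /\ reduced p.

End Paths.

Definition is_left_action (F : groupType) (X : Type) (act : F -> X -> X) :
    Prop :=
  (forall x, act 1 x = x) /\
  forall f g x, act (f * g) x = act f (act g x).

Record action_tree (F : groupType) := ActionTree {
  tree_graph :> graph;
  tree_is_tree : is_tree tree_graph;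
  vertex_act : F -> vertex tree_graph -> vertex tree_graph;
  edge_act : F -> edge tree_graph -> edge tree_graph;
  vertex_actP : is_left_action vertex_act;
  edge_actP : is_left_action edge_act;
  initial_act : forall f e, initial (edge_act f e) = vertex_act f (initial e);
  terminal_act :
    forall f e, terminal (edge_act f e) = vertex_act f (terminal e)
}.

Definition trivial_edge_stabilizers (F : groupType) (T : action_tree F) :
    Prop :=
  forall e : edge T, [set f : F | edge_act f e = e] = [set 1].

(* Main.v *)
From HB Require Import structures.
From Stdlib Require Import ZArith Lia.
Require Import Defs.
From mathcomp Require Import all_boot.
From mathcomp Require Import boolp classical_sets functions cardinality.

(** A tree is handled through its bridges: every edge separates it, and an
    edge "separates" two vertices when they are not connected without it. Fix
    a vertex [v0] on the axis of [r] and an edge [e] separating [v0] from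
    [r v0]. By induction on the number of [H]-translates of [e] with this
    property one shows, for every subgroup [H] containing [r], that the normal
    closure [N] of [r] in [H] has a basis of conjugates of [r], and that [N]
    acts freely on the components left after deleting the orbit [H e] (the
    Freiheitssatz).

    Let [F0] be generated by [r] and those translating elements. Unless [F0]
    is cyclic it splits as a free product, and local indicability of the
    factors yields a nonzero [phi : F0 -> Z] with [phi r = 0]. Its kernel acts
    on a tree whose vertices are the components of the forests of edges with
    heights in [i + lo, i + hi]; each stabilizer contains a single family of
    conjugates of [r] and satisfies the induction hypothesis, whose
    Freiheitssatz says that the normal closures in the vertex groups meet the
    edge groups trivially. For such a rotating family, ping-pong shows that
    the normal closures generate their free product over a suitable subtree.
    The same argument, on the tree of [H]-translates of the [F0]-part, passes
    from [F0] to [H]. *)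

Set Implicit Arguments.
Unset Strict Implicit.
Unset Printing Implicit Defensive.

Local Open Scope classical_set_scope.
Local Open Scope group_scope.

(** * Connectedness and trees *)

(** Two translates of [e] enter the induction step, one of least and one of greatest height, because
    a level of the height tree has two neighbours: the upper one omits the lowest height, the lower
    one the highest. The step gains because elements of the kernel preserve heights: among the
    separating edges, the translates of one extreme edge under a subgroup of the kernel all have
    that extreme height, so the other extreme is no longer counted.

    The map [phi] comes from two nontrivial free factors: local indicability gives each of them a
    nonzero map to the integers, and a combination of the two kills [r].

    The centralizer of [r] is treated by the same splitting, with the centralizer in place of [F0].
    Only finitely many translates of [e] separate [v0] from [r v0], so the centralizer is a finite
    union of cosets of the subgroup generated by [r]. A map to the integers that kills [r] is then
    bounded on it, hence zero, and only the cyclic case of the splitting remains. *)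

Inductive conn (T : Type) (R : T -> T -> Prop) (x : T) : T -> Prop :=
| conn0 : conn R x x
| connS y z : conn R x y -> R y z -> conn R x z.

Lemma conn1 T (R : T -> T -> Prop) x y : R x y -> conn R x y.
Proof. by apply: connS; apply: conn0. Qed.

Lemma conn_trans T (R : T -> T -> Prop) x y z : conn R x y -> conn R y z -> conn R x z.
Proof. by move=> xy; elim=> // u v _ xu; apply: connS. Qed.

Lemma conn_sym T (R : T -> T -> Prop) x y :
  (forall u v, R u v -> R v u) -> conn R x y -> conn R y x.
Proof.
move=> Rsym; elim=> [|u v _ ux uv]; first exact: conn0.
exact: conn_trans (conn1 (Rsym _ _ uv)) ux.
Qed.

Lemma conn_map T T' (R : T -> T -> Prop) (R' : T' -> T' -> Prop) (h : T -> T') x y :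
  (forall u v, R u v -> conn R' (h u) (h v)) -> conn R x y ->
  conn R' (h x) (h y).
Proof.
move=> RR'; elim=> [|u v _ xu uv]; first exact: conn0.
exact: conn_trans xu (RR' _ _ uv).
Qed.

Lemma sub_conn T (R S : T -> T -> Prop) x y :
  (forall u v, R u v -> S u v) -> conn R x y -> conn S x y.
Proof. by move=> RS; apply: (@conn_map _ _ R S id) => u v uv; apply/conn1/RS. Qed.

Lemma conn_inv T (R : T -> T -> Prop) (P : T -> Prop) x y :
  (forall u v, R u v -> P u -> P v) -> conn R x y -> P x -> P y.
Proof. by move=> RP; elim=> // u v _ xu /RP uv /xu. Qed.

(** Taking the last exit from [P] keeps the rest of the path outside [P]. *)
Lemma conn_exit T (R : T -> T -> Prop) (P : T -> Prop) x y :
  (forall u v, R u v -> R v u) ->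
  conn R x y -> P x -> ~ P y -> exists u v,
  [/\ R u v, P u, ~ P v & conn (fun s t => [/\ R s t, ~ P s & ~ P t]) v y].
Proof.
move=> Rsym; elim=> [//|u v _ IH uv Px Pv].
have [Pu|Pu] := pselect (P u).
  by exists u, v; split=> //; apply: conn0.
have [p [q [pq Pp Pq qu]]] := IH Px Pu.
by exists p, q; split=> //; apply: connS qu _; split.
Qed.

Section Tree.
Variables (V : Type) (adj : V -> V -> Prop).

Definition is_edge (u v x y : V) := (x = u /\ y = v) \/ (x = v /\ y = u).

Definition cut (u v x y : V) := adj x y /\ ~ is_edge u v x y.

(** Such a graph is a forest. Connectedness is a separate hypothesis, since rotating families only
    concern the component of a base vertex. *)
Definition bridged :=
  (forall u v, adj u v -> adj v u) /\ (forall u v, adj u v -> ~ conn (cut u v) u v).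

Lemma is_edgeC u v x y : is_edge u v x y -> is_edge u v y x.
Proof. by case=> -[-> ->]; [right|left]. Qed.

Lemma is_edgeCl u v x y : is_edge u v x y -> is_edge v u x y.
Proof. by case; [right|left]. Qed.

Lemma cutC u v x y : cut u v x y -> cut v u x y.
Proof. by case=> ? uv; split=> // /is_edgeCl. Qed.

Hypothesis Vt : bridged.

Let adjC u v : adj u v -> adj v u := Vt.1 u v.
Let bridge u v : adj u v -> ~ conn (cut u v) u v := Vt.2 u v.

Lemma cut_sym u v x y : cut u v x y -> cut u v y x.
Proof. by case=> /adjC xy nuv; split=> // /is_edgeC. Qed.

Lemma conn_cutC u v x y : conn (cut u v) x y -> conn (cut u v) y x.
Proof. exact: conn_sym (@cut_sym u v). Qed.

Lemma conn_cut_flip u v x y : conn (cut u v) x y -> conn (cut v u) x y.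
Proof. by apply: sub_conn => ? ?; apply: cutC. Qed.

Definition sep (x y u v : V) := ~ conn (cut x y) u v.

Lemma bridge_sep E p q x y : adj p q -> conn E x p -> conn E q y ->
  (forall u v, E u v -> cut p q u v) -> sep p q x y.
Proof.
move=> pq xp qy Ecut xy; apply: (bridge pq).
apply: conn_trans (conn_sym (@cut_sym p q) (sub_conn Ecut xp)) _.
exact: conn_trans xy (conn_sym (@cut_sym p q) (sub_conn Ecut qy)).
Qed.

Lemma adj_neq u v : adj u v -> u <> v.
Proof. by move=> uv euv; apply: (bridge uv); rewrite euv; apply: conn0. Qed.

Section Sep.
Variable E : V -> V -> Prop.
Hypothesis Eadj : forall u v, E u v -> adj u v.

Lemma sep_exists x y : conn adj x y -> ~ conn E x y ->
  exists p q, [/\ adj p q, ~ E p q, conn E x p & sep p q x y].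
Proof.
move=> xy nxy.
have [p [q [pq xp xq qy]]] := conn_exit adjC xy (conn0 _ _) nxy.
exists p, q; split=> //; first by move=> /(connS xp).
(* [E'] uses [E] inside the component of [x] and [adj] outside it, so it contains both parts of the
   path but not the exit edge. *)
pose E' s t := (E s t /\ conn E x s) \/ [/\ adj s t, ~ conn E x s & ~ conn E x t].
have step s : conn E x s -> conn E' x s.
  by elim=> [|u v xu IH uv]; [apply: conn0|apply: connS IH _; left].
apply: (@bridge_sep E') (step _ xp) _ _ => //.
  by apply: sub_conn qy => s t; right.
move=> s t [[Est xs]|[st xs xt]].
  split; first exact: Eadj.
  by case=> -[es et]; apply: xq; subst => //; apply: connS xs Est.
by split=> // -[[es et]|[es et]]; subst.
Qed.

End Sep.

(** In a forest an edge separating [x] from [y] lies on every path between them, so it belongs to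
    both subforests. *)
Lemma conn_cap E E' x y :
  (forall u v, E u v -> adj u v) -> (forall u v, E u v -> E v u) ->
  (forall u v, E' u v -> adj u v) -> (forall u v, E' u v -> E' v u) ->
  conn adj x y ->
  conn E x y -> conn E' x y -> conn (fun u v => E u v /\ E' u v) x y.
Proof.
move=> Ea Es E'a E's xy Exy E'xy; apply: contrapT => nxy.
have [|p [q [pq nE xp spq]]] := sep_exists _ xy nxy.
  by move=> u v [/Ea].
have [Epq|Epq] := pselect (E p q).
  apply: spq; apply: sub_conn E'xy => u v E'uv; split; first exact: E'a.
  by case=> -[eu ev]; subst; apply: nE; split=> //; apply: E's.
apply: spq; apply: sub_conn Exy => u v Euv; split; first exact: Ea.
by case=> -[eu ev]; subst; apply: Epq => //; apply: Es.
Qed.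

(** The half-tree beyond [v] across the edge from [u] to [v]. *)
Definition side (u v x : V) := conn (cut u v) v x.

Lemma side_refl u v : side u v v. Proof. exact: conn0. Qed.

Lemma sideN u v : adj u v -> ~ side u v u.
Proof. by move=> /bridge uv /conn_cutC. Qed.

Lemma side_conn u v x y : conn (cut u v) x y -> side u v x -> side u v y.
Proof. by move=> xy vx; apply: conn_trans xy. Qed.

Lemma side_conn_eq u v x y : conn (cut u v) x y -> side u v x <-> side u v y.
Proof. by move=> xy; split; apply: side_conn => //; apply: conn_cutC. Qed.

Lemma conn_side u v x y : side u v x -> side u v y -> conn (cut u v) x y.
Proof. by move=> /conn_cutC xv vy; apply: conn_trans vy. Qed.

Lemma side_compl u v x : conn adj u x -> ~ side u v x -> conn (cut u v) u x.
Proof.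
elim=> [_|y z _ IH yz nz]; first exact: conn0.
have [e|ne] := pselect (is_edge u v y z).
  case: e => -[ey ez]; subst; last exact: conn0.
  by case: nz; apply: side_refl.
have cyz : cut u v y z by [].
apply: (connS _ cyz); apply: IH => sy; apply: nz.
exact: connS sy cyz.
Qed.

Lemma sideC_conn u v x y : conn adj u x -> conn adj u y ->
  ~ side u v x -> ~ side u v y -> conn (cut u v) x y.
Proof.
by move=> ux uy /(side_compl ux)/conn_cutC xu /(side_compl uy); apply: conn_trans.
Qed.

Lemma side_step u v y z : adj y z -> side u v y -> ~ side u v z -> y = v /\ z = u.
Proof.
move=> yz sy sz; have [e|ne] := pselect (is_edge u v y z).
  case: e => -[ey ez] //; subst.
  by case: sz; apply: side_refl.
by case: sz; apply: connS sy _; split.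
Qed.

Lemma sepC x y u v : sep x y u v -> sep y x u v.
Proof. by move=> s /conn_cut_flip. Qed.

Lemma sepCr x y u v : sep x y u v -> sep x y v u.
Proof. by move=> s /conn_cutC. Qed.

End Tree.

(** * Ping-pong and free products *)

Section Direction.
Variables (V : Type) (adj : V -> V -> Prop).
Hypothesis Vt : bridged adj.

(** Deleting the vertex [x] leaves the directions at [x]; by [dir_uniq] each contains at most one
    neighbour of [x]. *)
Definition off (x s t : V) := [/\ adj s t, s <> x & t <> x].

Lemma off_sym x s t : off x s t -> off x t s.
Proof. by case=> /Vt.1. Qed.

Lemma off_neq x u y : u <> x -> conn (off x) u y -> y <> x.
Proof. by move=> ux; case=> // ? ? _ []. Qed.

Lemma dir_uniq x u u' : adj x u -> adj x u' -> conn (off x) u u' -> u = u'.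
Proof.
move=> xu xu' uu'; apply: contrapT => nuu'; apply: (Vt.2 _ _ xu).
have cxu' : cut adj x u x u'.
  split=> // -[[_ e]|[_ e]]; first by apply: nuu'.
  by move: xu'; rewrite e => /(adj_neq Vt).
apply: conn_trans (conn1 cxu') _; apply: (conn_sym (cut_sym Vt (u := x) (v := u))).
by apply: sub_conn uu' => s t [st sx tx]; split=> // -[[]|[]].
Qed.

(** A path from [u] off [x] that met [x'] would reach it. *)
Lemma conn_off x x' u y : ~ conn (off x) u x' -> conn (off x) u y ->
  conn (off x') u y.
Proof.
move=> nux'; elim=> [|s t us IH st]; first exact: conn0.
apply: connS IH _; case: st (st) => ? ? ? st; split=> // e; apply: nux'; subst=> //.
exact: connS us st.
Qed.

End Direction.

(** * Subgroups, homomorphisms and bases as subsets of a fixed group *)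

Section Subgroups.
Variable F : groupType.
Implicit Types (A Y : set F) (x y : F).

Lemma sg1 A : is_subgroup A -> A 1. Proof. by case. Qed.

Lemma sgV A x : is_subgroup A -> A x -> A x^-1.
Proof. by case=> A1 AF Ax; rewrite -div1g; apply: AF. Qed.

Lemma sgM A x y : is_subgroup A -> A x -> A y -> A (x * y).
Proof. by move=> Asg Ax Ay; rewrite -[y]invgK; apply: Asg.2 => //; apply: sgV. Qed.

Lemma sgX A x n : is_subgroup A -> A x -> A (x ^+ n).
Proof.
move=> Asg Ax; elim: n => [|n IH]; first exact: sg1.
by rewrite expgS; apply: sgM.
Qed.

Lemma is_subgroupI (A : set F) : A 1 -> (forall x, A x -> A x^-1) ->
  (forall x y, A x -> A y -> A (x * y)) -> is_subgroup A.
Proof. by move=> A1 AV AM; split=> // x y Ax /AV; apply: AM. Qed.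

Lemma mem_generated Y x : Y x -> generated Y x.
Proof. exact: sub_gen_smallest. Qed.

Lemma generated_min Y A : is_subgroup A -> Y `<=` A -> generated Y `<=` A.
Proof. by move=> Asg YA; apply: smallest_sub. Qed.

Lemma generatedS Y A : Y `<=` A -> generated Y `<=` generated A.
Proof.
move=> YA; apply: generated_min => [|x /YA]; first exact: is_subgroup_generated.
exact: mem_generated.
Qed.

Lemma generated_conj (g : F) Y : is_subgroup [set x | generated Y (g^-1 * x * g)].
Proof.
have sg := is_subgroup_generated Y; apply: is_subgroupI => /=.
- by rewrite mulg1 mulVg; apply: sg1.
- by move=> x /(sgV sg); rewrite !gnorm.
- by move=> x y gx /(sgM sg gx) /=; rewrite !mulgA mulgK.
Qed.

Definition conj_set (g : F) (Y : set F) : set F := [set x | Y (g^-1 * x * g)].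

Lemma conj_setK g Y : conj_set g^-1 (conj_set g Y) = Y.
Proof. by apply/seteqP; split=> x; rewrite /conj_set /= invgK !mulgA mulVg mul1g mulgVK. Qed.

Lemma generated_conj_set g Y : generated (conj_set g Y) = conj_set g (generated Y).
Proof.
suff H h Z : generated (conj_set h Z) `<=` conj_set h (generated Z).
  apply/seteqP; split; first exact: H.
  move=> x; rewrite -{1}[Y](conj_setK g) => /H.
  by rewrite /conj_set /= invgK !mulgA mulgV mul1g mulgK.
apply: generated_min; first exact: generated_conj.
by move=> x Zx; apply: (@mem_generated Z (h^-1 * x * h)).
Qed.

Definition hom_on (K : groupType) (A : set F) (phi : F -> K) :=
  forall x y, A x -> A y -> phi (x * y) = phi x * phi y.

Lemma hom_on1 (K : groupType) A (phi : F -> K) : is_subgroup A -> hom_on A phi -> phi 1 = 1.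
Proof.
move=> /sg1 A1 /(_ _ _ A1 A1); rewrite mul1g => e.
by apply: (mulgI (phi 1)); rewrite mulg1 -e.
Qed.

Lemma hom_onV (K : groupType) A (phi : F -> K) x : is_subgroup A -> hom_on A phi -> A x ->
  phi x^-1 = (phi x)^-1.
Proof.
move=> Asg h Ax; apply/esym/mulg1_eq.
by rewrite -h ?mulgV ?(hom_on1 Asg h) //; apply: sgV.
Qed.

(* A multiplicative relation that is total on [A] and relates [1] only to [1]
   is the graph of a homomorphism. *)
Lemma hom_of_rel (K : groupType) (A : set F) (Gam : F -> K -> Prop) :
  is_subgroup A -> (forall x, A x -> exists k, Gam x k) ->
  (forall x k y m, Gam x k -> Gam y m -> Gam (x * y) (k * m)) ->
  (forall x k, Gam x k -> Gam x^-1 k^-1) ->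
  (forall k, Gam 1 k -> k = 1) ->
  exists phi : F -> K, hom_on A phi /\ forall x k, Gam x k -> phi x = k.
Proof.
move=> Asg tot GM GV G1.
have uniq x k m : Gam x k -> Gam x m -> k = m.
  move=> xk xm; apply/divg1_eq/G1; rewrite -(mulgV x).
  by apply: GM => //; apply: GV.
have /choice[phi phiP] x : exists k, (exists m, Gam x m) -> Gam x k.
  have [[k xk]|no] := pselect (exists m, Gam x m); first by exists k.
  by exists 1.
exists phi; split=> [x y Ax Ay|x k xk]; last first.
  by apply: (uniq x) => //; apply: phiP; exists k.
have P z : A z -> Gam z (phi z) by move/tot; apply: phiP.
apply: (uniq (x * y)); first by apply: P; apply: sgM.
by apply: GM; apply: P.
Qed.

(** Uniqueness of the extension on [generated X] is automatic, and nothing is asked of [phi] outside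
    it. *)
Definition free_on (X : set F) := forall (K : groupType) (f : F -> K),
  exists phi : F -> K, hom_on (generated X) phi /\ forall x, X x -> phi x = f x.

(* [Y] is a Whitehead subset of [generated Y], up to the closure of [Y] under
   conjugation by [generated Y]. *)
Definition Wh (Y : set F) := exists X : set F, [/\ X `<=` Y, free_on X,
  Y `<=` generated X & forall y, Y y ->
    exists n, generated Y n /\ X (n * y * n^-1)].

End Subgroups.

Section PingPong.
Variables (F : groupType) (W : Type) (act : F -> W -> W).
Hypothesis actP : is_left_action act.
Variable adj : W -> W -> Prop.
Hypothesis Wt : bridged adj.
Variable G : set F.
Hypothesis G_sg : is_subgroup G.
Hypothesis G_adj : forall g x y, G g -> adj x y -> adj (act g x) (act g y).
Variable Ng : W -> set F.
Hypothesis Ng_sg : forall w, is_subgroup (Ng w).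
Hypothesis Ng_sub : forall w, Ng w `<=` G.
Hypothesis Ng_fix : forall w n, Ng w n -> act n w = w.

Lemma act1 x : act 1 x = x. Proof. exact: actP.1. Qed.
Lemma actM f g x : act (f * g) x = act f (act g x). Proof. exact: actP.2. Qed.
Lemma actK f : cancel (act f) (act f^-1).
Proof. by move=> x; rewrite -actM mulVg act1. Qed.
Lemma actVK f : cancel (act f^-1) (act f).
Proof. by move=> x; rewrite -actM mulgV act1. Qed.
Lemma act_inj f : injective (act f). Proof. exact: can_inj (actK f). Qed.

Variable D : set W.
Hypothesis D_conn : forall x y, D x -> D y ->
  conn (fun s t => [/\ adj s t, D s & D t]) x y.
Hypothesis D_free : forall x u v n, D x -> D u -> D v -> adj x u -> adj x v ->
  Ng x n -> act n u = v -> n = 1.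

(** A word is a list of syllables, each paired with the vertex whose group it comes from. *)
Fixpoint wprod (l : seq (W * F)) : F :=
  if l is p :: l' then p.2 * wprod l' else 1.

Fixpoint wok (l : seq (W * F)) : Prop :=
  if l is p :: l' then [/\ D p.1, Ng p.1 p.2 & wok l'] else True.

Fixpoint wred (l : seq (W * F)) : Prop :=
  if l is p :: l' then
    [/\ p.2 <> 1, (if l' is q :: _ then p.1 <> q.1 else True) & wred l']
  else True.

Lemma D_dir x y : D x -> D y -> x <> y ->
  exists u, [/\ D u, adj x u & conn (off adj x) u y].
Proof.
move=> Dx Dy nxy.
have Dsym s t : [/\ adj s t, D s & D t] -> [/\ adj t s, D t & D s].
  by case=> /Wt.1.
have nyx : ~ (y = x) by move=> e; apply: nxy.
have [u [v [[uv Du Dv] eu nv vy]]] :=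
  conn_exit (P := fun z => z = x) Dsym (D_conn Dx Dy) erefl nyx.
exists v; split=> //; first by rewrite -eu.
by apply: sub_conn vy => s t [[st _ _] sx tx].
Qed.

Lemma off_act g x u y : G g -> conn (off adj x) u y ->
  conn (off adj (act g x)) (act g u) (act g y).
Proof.
move=> Gg; apply: (@conn_map _ _ _ _ (act g)) => s t [st sx tx]; apply: conn1.
by split; [apply: G_adj|move/act_inj|move/act_inj].
Qed.

(* Ping-pong: the syllables of a reduced word turn by an element of [Ng w] at
   every vertex [w] of [D] they visit, so its translates of [D] never return. *)
Lemma pingpong l w n w' : wok ((w, n) :: l) -> wred ((w, n) :: l) -> D w' ->
  w' <> last w (map fst l) -> exists u, [/\ D u, adj w u &
    conn (off adj w) (act n u) (act (wprod ((w, n) :: l)) w')].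
Proof.
elim: l w n => [|[w2 n2] l IH] w n /= [Dw nw ok].
  move=> _ Dw' /nesym nw'; have [u [Du wu uw']] := D_dir Dw Dw' nw'.
  exists u; split=> //; rewrite mulg1 -{1}(Ng_fix nw).
  by apply: off_act => //; apply: Ng_sub nw.
case=> n1 nww2 red Dw' lw'; have [Dw2 nw2 _] := ok.
have [u2 [Du2 w2u2 u2y]] := IH w2 n2 ok red Dw' lw'.
have [u [Du wu uw2]] := D_dir Dw Dw2 nww2.
have [u1 [Du1 w2u1 u1w]] := D_dir Dw2 Dw (nesym nww2).
have w2n2u2 : adj w2 (act n2 u2).
  by rewrite -{1}(Ng_fix nw2); apply: G_adj => //; apply: Ng_sub nw2.
(* The rest of the word leaves [w2] in the direction [act n2 u2]. If [w] lay there too, this would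
   be the direction [u1] of [w], and [D_free] would give [n2 = 1]. *)
have nin : ~ conn (off adj w2) (act n2 u2) w.
  move=> nuw; have wu1 := conn_sym (@off_sym _ _ Wt w2) u1w.
  have c := conn_trans nuw wu1.
  have e := dir_uniq Wt w2n2u2 w2u1 c.
  by have [] := red; rewrite (D_free Dw2 Du2 Du1 w2u2 w2u1 nw2 e).
exists u; split=> //; set y := wprod _ in u2y *.
rewrite actM -{1}(Ng_fix nw); apply: off_act; first exact: Ng_sub nw.
apply: conn_trans uw2 _; apply: conn_trans (conn_off nin u2y); apply: conn1.
by split=> // [/esym //|e]; apply: nin; rewrite e; apply: conn0.
Qed.

(** A fixed [w'] would lie in the direction [act n u] at [w] and also in a direction of [D], so
    [D_free] would kill [n]. The quantified [w] is only the default value of [last]. *)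
Lemma pingpong_neq l w' : l <> [::] -> wok l -> wred l -> D w' ->
  (forall w, w' <> last w (map fst l)) -> act (wprod l) w' <> w'.
Proof.
case: l => [//|[w n] l] _ ok red Dw' lw' e.
have [/= Dw nw _] := ok; have [/= n1 _ _] := red.
have [u [Du wu]] := pingpong ok red Dw' (lw' w).
rewrite e => nuw'; have wnu : adj w (act n u).
  by rewrite -{1}(Ng_fix nw); apply: G_adj => //; apply: Ng_sub nw.
have ww' : w <> w'.
  by apply/nesym; apply: off_neq nuw'; apply/nesym; apply: adj_neq wnu.
have [v [Dv wv vw']] := D_dir Dw Dw' ww'.
apply: n1; apply: (D_free Dw Du Dv wu wv nw).
apply: (dir_uniq Wt wnu wv).
exact: conn_trans nuw' (conn_sym (@off_sym _ _ Wt w) vw').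
Qed.

(** Consecutive syllables sit at different vertices, so the first or the second vertex differs from
    the last one, and the word moves it. *)
Lemma wred_prod1 l : wok l -> wred l -> wprod l = 1 -> l = [::].
Proof.
case: l => [//|[w n] [|[w2 n2] l]] ok red e.
  by case: red => n1; case: n1; rewrite -e /= mulg1.
have [/= Dw _ [Dw2 _ _]] := ok; have [/= _ ww2 _] := red; exfalso.
have [e2|ne] := pselect (w = last w (map fst ((w, n) :: (w2, n2) :: l))).
  apply: (pingpong_neq (w' := w2) _ ok red Dw2) => //; last by rewrite e act1.
  by move=> w0 /= e3; apply: ww2; rewrite e2 /= -e3.
apply: (pingpong_neq (w' := w) _ ok red Dw) => //.
by rewrite e act1.
Qed.

Lemma wok_rcons l p : wok (rcons l p) -> [/\ D p.1, Ng p.1 p.2 & wok l].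
Proof.
by elim: l => [|q l IH] /=; [case|case=> Dq nq /IH[]].
Qed.

Lemma wred_rcons l p : wred (rcons l p) ->
  wred l /\ (l = [::] \/ forall w, p.1 <> last w (map fst l)).
Proof.
elim: l => [|q l IH] /=; first by split=> //; left.
move=> [q1 ne /IH[redl H]].
split.
  by split=> //; case: l ne {IH redl H}.
right=> w; case: H => [e|H]; last exact: H.
by move: ne; rewrite e /= => /nesym.
Qed.

Lemma wprod_rcons l p : wprod (rcons l p) = wprod l * p.2.
Proof. by elim: l => [|q l IH] /=; rewrite ?mulg1 ?mul1g // IH mulgA. Qed.

(** Dropping a last syllable at [w], which fixes [w], leaves a word that ends elsewhere and so moves
    [w] unless it is empty. *)
Lemma wred_stab l w : wok l -> wred l -> D w -> act (wprod l) w = w ->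
  Ng w (wprod l).
Proof.
case: (lastP l) => [|l' [w1 n]] ok red Dw e; first exact: sg1.
have [/= Dw1 nw1 ok'] := wok_rcons ok; have [red' H] := wred_rcons red.
have [ew1|nw] := pselect (w = w1).
  subst w1; move: e; rewrite !wprod_rcons /= actM (Ng_fix nw1) => e.
  case: H => [->|H]; first by rewrite mul1g.
  have [->|l'0] := pselect (l' = [::]); first by rewrite /= mul1g.
  by have /(_ H) := pingpong_neq l'0 ok' red' Dw.
exfalso; apply: pingpong_neq ok red Dw _ e; first by case: (l').
by move=> w0; rewrite map_rcons last_rcons.
Qed.

Section Reduce.
Variables (K : groupType) (alpha : W -> F -> K).
Hypothesis alpha_hom : forall w, D w -> hom_on (Ng w) (alpha w).

Fixpoint aprod (l : seq (W * F)) : K :=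
  if l is p :: l' then alpha p.1 p.2 * aprod l' else 1.

(** Merging syllables changes neither product. With [wred_prod1] this makes the value of [aprod]
    depend only on [wprod]. *)
Lemma word_reduce l : wok l -> exists l', [/\ wok l', wred l',
  wprod l' = wprod l & aprod l' = aprod l].
Proof.
elim: l => [|[w n] l IH] /= ok; first by exists [::].
have [/= Dw nw /IH[l' [ok' red' <- <-]]] := ok.
have [->|n1] := pselect (n = 1).
  by exists l'; rewrite (hom_on1 (Ng_sg w) (alpha_hom Dw)) !mul1g.
case: l' ok' red' => [|[w' n'] l'] ok' red'; first by exists [:: (w, n)].
have [e|nww'] := pselect (w = w'); last by exists [:: (w, n), (w', n') & l'].
subst w'; have [/= _ nw' ok''] := ok'; have [/= _ hd red''] := red'.
rewrite /= !mulgA -(alpha_hom Dw) //.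
have [->|nn'] := pselect (n * n' = 1).
  by exists l'; rewrite (hom_on1 (Ng_sg w) (alpha_hom Dw)) !mul1g.
exists ((w, n * n') :: l'); split=> //=.
by split=> //; apply: sgM.
Qed.

End Reduce.

Definition word_group := generated [set n | exists2 w, D w & Ng w n].

Lemma wok_cat l l' : wok l -> wok l' -> wok (l ++ l').
Proof. by elim: l => //= p l IH [Dp np /IH H] /H. Qed.

Lemma wprod_cat l l' : wprod (l ++ l') = wprod l * wprod l'.
Proof. by elim: l => [|p l IH] /=; rewrite ?mul1g // IH mulgA. Qed.

Definition winv (l : seq (W * F)) := rev (map (fun p => (p.1, p.2^-1)) l).

Lemma wok_inv l : wok l -> wok (winv l).
Proof.
elim: l => [//|p l IH] [Dp np /IH okl]; rewrite /winv /= rev_cons -cats1.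
by apply: wok_cat => //; split=> //=; apply: sgV.
Qed.

Lemma wprod_inv l : wprod (winv l) = (wprod l)^-1.
Proof.
elim: l => [|p l IH]; first by rewrite invg1.
by rewrite /winv /= rev_cons wprod_rcons -/(winv l) IH invgM.
Qed.

Lemma word_groupP n : word_group n -> exists2 l, wok l & wprod l = n.
Proof.
apply: (@generated_min _ _ [set n | exists2 l, wok l & wprod l = n]).
  apply: is_subgroupI => [|x [l ok <-]|x y [l ok <-] [l' ok' <-]].
  - by exists [::].
  - by exists (winv l); [apply: wok_inv|apply: wprod_inv].
  - by exists (l ++ l'); [apply: wok_cat|apply: wprod_cat].
by move=> {}n [w Dw nw]; exists [:: (w, n)]; rewrite //= mulg1.
Qed.

(** The universal property of the free product of the groups [Ng w] over [D]. *)
Lemma word_group_hom (K : groupType) (alpha : W -> F -> K) :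
  (forall w, D w -> hom_on (Ng w) (alpha w)) ->
  exists phi : F -> K, hom_on word_group phi /\
    forall w n, D w -> Ng w n -> phi n = alpha w n.
Proof.
move=> ha; pose Gam x k := exists l, [/\ wok l, wprod l = x & aprod alpha l = k].
have acat l l' : aprod alpha (l ++ l') = aprod alpha l * aprod alpha l'.
  by elim: l => [|p l IH] /=; rewrite ?mul1g // IH mulgA.
have [] := @hom_of_rel _ K word_group Gam (is_subgroup_generated _).
- by move=> x /word_groupP[l ok e]; exists (aprod alpha l), l.
- move=> x k y m [l [ok <- <-]] [l' [ok' <- <-]]; exists (l ++ l').
  by rewrite wprod_cat acat; split=> //; apply: wok_cat.
- move=> x k [l [ok <- <-]]; exists (winv l).
  rewrite wprod_inv; split=> //; first exact: wok_inv.
  elim: l ok => [|p l IH] ok; first by rewrite invg1.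
  have [/= Dp np okl] := ok; rewrite /winv /= rev_cons -cats1 acat IH //= mulg1.
  by rewrite (hom_onV (Ng_sg _) (ha _ Dp) np) invgM.
- move=> k [l [ok e1 <-]]; have [l' [ok' red' e <-]] := word_reduce ha ok.
  by rewrite (wred_prod1 ok' red') // e.
move=> phi [phom phiP]; exists phi; split=> // w n Dw nw.
by apply: phiP; exists [:: (w, n)]; rewrite /= !mulg1.
Qed.

Lemma word_group_stab n w : word_group n -> D w -> act n w = w -> Ng w n.
Proof.
move=> /word_groupP[l ok <-] Dw.
have [l' [ok' red' <- _]] := word_reduce (K := F) (alpha := fun _ => id)
  (fun _ _ _ _ _ _ => erefl) ok.
exact: wred_stab.
Qed.

End PingPong.

(** * Rotating families on a tree *)

Section Rotation.
Variables (F : groupType) (W : Type) (act : F -> W -> W).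
Hypothesis actP : is_left_action act.
Variable adj : W -> W -> Prop.
Hypothesis Wt : bridged adj.
Variable G : set F.
Hypothesis G_sg : is_subgroup G.
Hypothesis G_adj : forall g x y, G g -> adj x y -> adj (act g x) (act g y).
Variable Ng : W -> set F.
Hypothesis Ng_sg : forall w, is_subgroup (Ng w).
Hypothesis Ng_sub : forall w, Ng w `<=` G.
Hypothesis Ng_fix : forall w n, Ng w n -> act n w = w.
Hypothesis Ng_act : forall g w, G g -> Ng (act g w) = conj_set g (Ng w).
Hypothesis Ng_adj : forall x u n, adj x u -> Ng x n -> act n u = u -> n = 1.
Variable w0 : W.

Variable rep : W -> W -> W.
Hypothesis repP : forall x u, exists2 n, Ng x n & rep x u = act n u.
Hypothesis rep_eq : forall x u n, Ng x n -> rep x (act n u) = rep x u.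

(* A subtree containing, around each of its vertices [x], one neighbour from
   each [Ng x]-orbit; the first argument is the predecessor of [x] on the way
   from [w0]. *)
Inductive span : option W -> W -> Prop :=
| span0 : span None w0
| spanS o x u : span o x -> adj x u -> rep x u = u ->
    (forall y n, o = Some y -> Ng x n -> act n y <> u) -> span (Some x) u.

Definition span_dom : set W := fun x => exists o, span o x.

(** The predecessor of a vertex points towards [w0], so a vertex enters the span in only one way. *)
Lemma span_away o x : span o x ->
  if o is Some y then [/\ adj x y, conn (off adj x) y w0, x <> w0 & span_dom y]
  else x = w0.
Proof.
elim=> {o x} [//|o x u sx IH xu ru oN].
have Dx : span_dom x by exists o.
case: o => [y|] in sx IH oN *; last first.
  rewrite IH in xu *; split=> //; [exact: Wt.1|exact: conn0| |by rewrite -IH].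
  by apply/nesym; apply: adj_neq xu.
have {}oN : u <> y.
  by move=> e; apply: (oN y 1 erefl) => //; [apply: sg1|rewrite actP.1].
have [xy yw0 _ _] := IH.
have nyu : ~ conn (off adj x) y u.
  by move=> /(dir_uniq Wt xy xu) e; apply: oN.
have xu' := nesym (adj_neq Wt xu).
split=> //; first exact: Wt.1.
  apply: conn_trans (conn_off nyu yw0); apply: conn1.
  by split=> //; apply/nesym.
by move=> e; apply: nyu; rewrite e.
Qed.

Lemma span_uniq o o' x : span o x -> span o' x -> o = o'.
Proof.
move=> /span_away s /span_away s'.
case: o s => [y|] s; case: o' s' => [y'|] s' //.
- have [xy yw0 _ _] := s; have [xy' yw0' _ _] := s'; congr Some.
  apply: (dir_uniq Wt xy xy').
  exact: conn_trans yw0 (conn_sym (@off_sym _ _ Wt x) yw0').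
- by case: s => _ _; case.
- by case: s' => _ _; case.
Qed.

(** If [u] is not the predecessor of [x], then [w0] lies at or beyond [x] as seen from [u], so [x]
    is the predecessor of [u]. *)
Lemma span_nbr o x u : span o x -> span_dom u -> adj x u ->
  o = Some u \/
  (rep x u = u /\ forall y n, o = Some y -> Ng x n -> act n y <> u).
Proof.
move=> sx [o' su] xu; have [|ou] := pselect (o = Some u); [by left|right].
have [xw0 uw0] : conn (off adj u) x w0 /\ u <> w0.
  move: (span_away sx); case: o sx ou => [y|] sx ou.
    case=> xy yw0 _ _.
    have nyu : ~ conn (off adj x) y u.
      by move=> /(dir_uniq Wt xy xu) e; apply: ou; rewrite e.
    split; last by move=> e; apply: nyu; rewrite e.
    apply: conn_trans (conn_off nyu yw0); apply: conn1.
    split=> //; first exact: adj_neq xu.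
    by move=> e; apply: ou; rewrite e.
  move=> e; rewrite e in xu *; split; first exact: conn0.
  by apply/nesym; apply: adj_neq xu.
move: (span_away su); case: o' su => [y'|] su //.
case=> uy' y'w0 _ _.
have e : x = y'.
  apply: (dir_uniq Wt (Wt.1 _ _ xu) uy').
  exact: conn_trans xw0 (conn_sym (@off_sym _ _ Wt u) y'w0).
move: su; rewrite -e => su.
inversion su as [|o'' x' u' sx' xu' ru' oN']; subst.
by split=> //; rewrite (span_uniq sx sx').
Qed.

Lemma span_conn x y : span_dom x -> span_dom y ->
  conn (fun s t => [/\ adj s t, span_dom s & span_dom t]) x y.
Proof.
have base z : span_dom z ->
    conn (fun s t => [/\ adj s t, span_dom s & span_dom t]) w0 z.
  case=> o; elim=> {o z} [|o x' u sx IH xu ru oN]; first exact: conn0.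
  apply: connS IH _; split=> //; first by exists o.
  by exists (Some x'); apply: spanS oN.
move=> /base w0x /base w0y; apply: conn_trans w0y; apply: conn_sym w0x.
by move=> u v [/Wt.1].
Qed.

(** Neighbours of [x] in the span that share an [Ng x]-orbit coincide, by the choice of
    representatives and the exclusion of the orbit of the predecessor; then [Ng_adj] applies. *)
Lemma span_free x u v n : span_dom x -> span_dom u -> span_dom v ->
  adj x u -> adj x v -> Ng x n -> act n u = v -> n = 1.
Proof.
move=> [o sx] Du Dv xu xv nx e.
have [ou|[ru oNu]] := span_nbr sx Du xu; have [ov|[rv oNv]] := span_nbr sx Dv xv.
- by apply: (Ng_adj xu nx); rewrite e; move: ou; rewrite ov => -[].
- by case: (oNv _ _ ou nx).
- case: (oNu _ n^-1 ov); first exact: sgV.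
  by rewrite -e actK.
- by apply: (Ng_adj xu nx); rewrite e -rv -e rep_eq.
Qed.

Definition span_group := word_group Ng span_dom.

Lemma span_group_sub : span_group `<=` G.
Proof. by apply: generated_min => // n [w _ /Ng_sub]. Qed.

Lemma mem_span_group x n : span_dom x -> Ng x n -> span_group n.
Proof.
move=> Dx nx.
by apply: (@mem_generated _ [set n | exists2 w, span_dom w & Ng w n]); exists x.
Qed.

(** Along a path from [w0], once [x] has been moved into the span, its next neighbour is rotated
    about it, onto the predecessor or onto a chosen representative. *)
Lemma span_cover w : conn adj w0 w -> exists2 m, span_group m & span_dom (act m w).
Proof.
have sgN := is_subgroup_generated [set n | exists2 w, span_dom w & Ng w n].
elim=> [|x u _ [m Nm Dmx] xu].
  by exists 1; [apply: sg1|rewrite actP.1; exists None; apply: span0].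
have [o smx] := Dmx; set mx := act m x in smx Dmx; set mu := act m u.
have amxu : adj mx mu by apply: G_adj => //; apply: span_group_sub.
have [[y [n [eo nn e]]]|no] :=
    pselect (exists y n, [/\ o = Some y, Ng mx n & act n y = mu]).
  exists (n^-1 * m).
    by apply: (sgM sgN) => //; apply: (sgV sgN); apply: (mem_span_group _ nn).
  rewrite actP.2 -/mu -e actK //.
  by move: (span_away smx); rewrite eo => -[].
have [n nn e] := repP mx mu.
exists (n * m); first by apply: (sgM sgN) => //; apply: (mem_span_group _ nn).
rewrite actP.2 -/mu -e; exists (Some mx); apply: (spanS smx).
- by rewrite e -{1}(Ng_fix nn); apply: G_adj => //; apply: Ng_sub nn.
- by rewrite e rep_eq.
- move=> y n' eo nn' e'; apply: no; exists y, (n^-1 * n'); split=> //.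
    by apply: sgM => //; apply: sgV.
  by rewrite actP.2 e' e actK.
Qed.

Hypothesis Ng_reach : forall w n, Ng w n -> n = 1 \/ conn adj w0 w.

Lemma Ng_span w : Ng w `<=` span_group.
Proof.
move=> n nw; have sgN := is_subgroup_generated
  [set n | exists2 w, span_dom w & Ng w n].
have [->|/span_cover[m Nm Dmw]] := Ng_reach nw; first exact: sg1.
have : Ng (act m w) (m * n * m^-1).
  by rewrite Ng_act ?/conj_set /= ?mulgA ?mulVg ?mul1g ?mulgVK //; apply: span_group_sub.
move=> /(mem_span_group Dmw) H.
have := sgM sgN (sgM sgN (sgV sgN Nm) H) Nm.
by rewrite !mulgA mulVg mul1g mulgVK.
Qed.

Lemma span_group_stab w n : conn adj w0 w -> span_group n -> act n w = w -> Ng w n.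
Proof.
move=> /span_cover[m Nm Dmw] Nn nw.
have sgN := is_subgroup_generated [set n | exists2 w, span_dom w & Ng w n].
have Gm := span_group_sub Nm.
have : Ng (act m w) (m * n * m^-1).
  apply: (word_group_stab actP Wt G_adj Ng_sg Ng_sub Ng_fix span_conn span_free) => //.
    by apply: (sgM sgN) => //; [apply: (sgM sgN)|apply: (sgV sgN)].
  by rewrite !actP.2 actK // nw.
by rewrite Ng_act // /conj_set /= !mulgA mulVg mul1g mulgVK.
Qed.

End Rotation.

Section RotationWh.
Variables (F : groupType) (W : Type) (act : F -> W -> W).
Hypothesis actP : is_left_action act.
Variable adj : W -> W -> Prop.
Hypothesis Wt : bridged adj.
Variable G : set F.
Hypothesis G_sg : is_subgroup G.
Hypothesis G_adj : forall g x y, G g -> adj x y -> adj (act g x) (act g y).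
Variable Y : W -> set F.
Hypothesis Y_sub : forall w, Y w `<=` G.
Hypothesis Y_fix : forall w y, Y w y -> act y w = w.
Hypothesis Y_act : forall g w, G g -> Y (act g w) = conj_set g (Y w).
Hypothesis Y_adj : forall x u n,
  adj x u -> generated (Y x) n -> act n u = u -> n = 1.
Variable w0 : W.
Hypothesis Y_reach : forall w y, Y w y -> conn adj w0 w.
Hypothesis Y_Wh : forall w, Wh (Y w).

(** All the [Y w] together generate the free product of the groups over the span, so the bases there
    combine to a basis; [span_cover] conjugates every other relator into the span. *)
Theorem rotation :
  let Y' := [set y | exists w, Y w y] in
  Wh Y' /\ forall w n, conn adj w0 w -> generated Y' n -> act n w = w ->
    generated (Y w) n.
Proof.
move=> Y'; have [Ng NgE] : exists Ng : W -> set F, forall w, generated (Y w) = Ng w.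
  by exists (fun w => generated (Y w)).
have Ng_sg w : is_subgroup (Ng w) by rewrite -NgE; apply: is_subgroup_generated.
have Ng_sub w : Ng w `<=` G by rewrite -NgE; apply: generated_min.
have Ng_fix w n : Ng w n -> act n w = w.
  rewrite -NgE.
  apply: (@generated_min _ _ [set n | act n w = w]); last exact: Y_fix.
  apply: is_subgroupI => /= [|x e|x y e1 e2]; first exact: actP.1.
    by rewrite -{1}e actK.
  by rewrite actP.2 e2 e1.
have Ng_act g w : G g -> Ng (act g w) = conj_set g (Ng w).
  by move=> Gg; rewrite -!NgE Y_act // generated_conj_set.
have Ng_reach w n : Ng w n -> n = 1 \/ conn adj w0 w.
  have [|no] := pselect (conn adj w0 w); [by right|rewrite -NgE].
  apply: (@generated_min _ _ [set n | n = 1 \/ conn adj w0 w]).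
    apply: is_subgroupI => /= [|x|x y]; first by left.
      by case=> [->|]; [left; rewrite invg1|right].
    by case=> [->|?]; [rewrite mul1g|right].
  by move=> y /Y_reach; right.
(* Choosing from the orbit as a set makes [rep] constant on orbits. *)
have /choice[ch chP] (S : set W) : exists x, (exists y, S y) -> S x.
  by have [[y Sy]|no] := pselect (exists y, S y); [exists y|exists w0].
pose rep x u := ch [set v | exists2 n, Ng x n & v = act n u].
have repP x u : exists2 n, Ng x n & rep x u = act n u.
  apply: (chP [set v | exists2 n, Ng x n & v = act n u]).
  by exists u, 1; [apply: (sg1 (Ng_sg x))|rewrite actP.1].
have rep_eq x u n : Ng x n -> rep x (act n u) = rep x u.
  move=> nx; congr ch; apply/seteqP; split=> v /= [m mx ->].
    by exists (m * n); [apply: (sgM (Ng_sg x))|rewrite actP.2].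
  exists (m * n^-1); first by apply: (sgM (Ng_sg x)) => //; apply: (sgV (Ng_sg x)).
  by rewrite actP.2 actK.
have Ng_adj x u n : adj x u -> Ng x n -> act n u = u -> n = 1.
  by rewrite -NgE; apply: Y_adj.
pose D := span_dom act adj Ng w0 rep; pose N := span_group act adj Ng w0 rep.
have NE : N = generated Y'.
  apply/seteqP; split; apply: generated_min; try exact: is_subgroup_generated.
    move=> n [w Dw]; rewrite -NgE; apply: generatedS => y Yy; by exists w.
  move=> y [w Yw]; have NgN : Ng w `<=` N by apply (@Ng_span F W act actP adj Wt G).
  by apply: NgN; rewrite -NgE; apply: mem_generated.
have stab w n : conn adj w0 w -> generated Y' n -> act n w = w -> Ng w n.
  by rewrite -NE; apply (@span_group_stab F W act actP adj Wt G) .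
split; last by move=> w n; rewrite NgE; apply: stab.
have /choice[X XP] w : exists X : set F, [/\ X `<=` Y w, free_on X,
  Y w `<=` generated X & forall y, Y w y ->
    exists n, generated (Y w) n /\ X (n * y * n^-1)] by apply: Y_Wh.
have XN w : generated (X w) = Ng w.
  have [XY _ YX _] := XP w; rewrite -NgE; apply/seteqP; split.
    exact: generatedS.
  by apply: generated_min YX; apply: is_subgroup_generated.
pose X' := [set x | exists2 w, D w & X w x].
have NX' : N `<=` generated X'.
  apply: generated_min; first exact: is_subgroup_generated.
  move=> n [w Dw]; rewrite -XN; apply: generatedS => x Xx; by exists w.
have X'Y' : X' `<=` Y'.
  by move=> x [w Dw Xx]; exists w; have [XY _ _ _] := XP w; apply: XY.
exists X'; split=> //.
- move=> K f.
  have /choice[alpha alphaP] w : exists phi : F -> K,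
      hom_on (Ng w) phi /\ forall x, X w x -> phi x = f x.
    by rewrite -XN; have [_ fX _ _] := XP w; apply: fX.
  have [phi [phom phiP]] := word_group_hom actP Wt G_adj Ng_sg Ng_sub
    Ng_fix (D := D) (@span_conn _ _ _ _ Wt _ _ _)
    (@span_free _ _ _ actP _ Wt _ Ng_sg Ng_adj _ _ rep_eq)
    (alpha := alpha) (fun w _ => (alphaP w).1).
  exists phi; split.
    move=> x y X'x X'y; have sub : generated X' `<=` N.
      by rewrite NE; apply: generatedS.
    by apply: phom; apply: sub.
  move=> x [w Dw Xx]; rewrite (phiP w) //; first exact: (alphaP w).2.
  by rewrite -XN; apply: mem_generated.
- by move=> y Yy; apply: NX'; rewrite NE; apply: mem_generated.
- move=> y [w Yw].
  have [m Nm Dmw] : exists2 m, N m & D (act m w).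
    apply (@span_cover F W act actP adj Wt G) with (Ng := Ng) => //.
    exact: Y_reach Yw.
  have Gm : G m.
    move: m Nm {Dmw}; apply: generated_min => // n [w' _ nw']; exact: Ng_sub nw'.
  have Ymw : Y (act m w) (m * y * m^-1).
    by rewrite Y_act // /conj_set /= !mulgA mulVg mul1g mulgVK.
  have [_ _ _ XC] := XP (act m w); have [n [nn Xn]] := XC _ Ymw.
  exists (n * m); split.
    rewrite -NE; have sgN : is_subgroup N by apply: is_subgroup_generated.
    have NgN : Ng (act m w) `<=` N by move=> k; apply (@mem_span_group F W act adj Ng).
    by apply: (sgM sgN) => //; apply: NgN; rewrite -NgE.
  by exists (act m w) => //; move: Xn; rewrite invgM !mulgA.
Qed.

End RotationWh.

(** * Trees of trees and hyperbolic elements *)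

Section TreeOfTrees.
Variables (V : Type) (adj : V -> V -> Prop) (Lam : Type) (ladj : Lam -> Lam -> Prop).
Hypothesis Vt : bridged adj.
Hypothesis Vconn : forall u v, conn adj u v.
Hypothesis Lt : bridged ladj.
Hypothesis Lconn : forall k l, conn ladj k l.
Variable J : V -> V -> Lam -> Prop.
Hypothesis JC : forall u v l, J u v l -> J v u l.
Hypothesis J_conn : forall u v k l, adj u v -> J u v k -> J u v l ->
  conn (fun s t => [/\ ladj s t, J u v s & J u v t]) k l.

Definition lvl (l : Lam) (u v : V) := adj u v /\ J u v l.

Definition lcomp (l : Lam) (v : V) : set V := [set w | conn (lvl l) v w].

(* One copy of the tree [Lam] over each vertex of the tree [V], those over the
   ends of an edge [u v] being glued along the subtree [J u v]. *)
Definition tadj (x y : Lam * set V) :=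
  ladj x.1 y.1 /\ exists v, x.2 = lcomp x.1 v /\ y.2 = lcomp y.1 v.

Lemma lvl_sym l u v : lvl l u v -> lvl l v u.
Proof. by case=> /Vt.1 uv /JC. Qed.

Lemma lvl_adj l u v : lvl l u v -> adj u v.
Proof. by case. Qed.

Lemma lcomp_refl l v : lcomp l v v.
Proof. exact: conn0. Qed.

Lemma lcomp_eq l u v : lcomp l u = lcomp l v <-> conn (lvl l) u v.
Proof.
split=> [e|uv]; first by have : lcomp l v v := lcomp_refl l v; rewrite -e.
have vu := conn_sym (@lvl_sym l) uv.
by apply/seteqP; split=> w; [apply: conn_trans vu|apply: conn_trans uv].
Qed.

Section Cut.
Variables (k l : Lam) (v0 : V).
Hypothesis kl : ladj k l.

Let P0 v := conn (lvl k) v0 v /\ conn (lvl l) v0 v.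
Let lside := side ladj k l.

(** Tells on which side of the edge from [k] to [l] over [v0] the point over [v] at level [m] lies.
    Over [P0], where that edge is shared, the side of [m] decides. Elsewhere the edge from [p] to
    [q] that leaves [P0] decides: the subtree [J p q] does not contain both [k] and [l], so it lies
    on one side. *)
Let side_of v m := (P0 v /\ lside m) \/
  (~ P0 v /\ exists p q n, [/\ P0 p /\ ~ P0 q, adj p q,
     conn (fun s t => [/\ adj s t, ~ P0 s & ~ P0 t]) q v, J p q n & lside n]).

Let P0_step u v : P0 u -> lvl k u v -> lvl l u v -> P0 v.
Proof. by case=> ku lu kuv luv; split; [apply: connS kuv|apply: connS luv]. Qed.

Let exit_const p q m n : P0 p -> ~ P0 q -> adj p q -> J p q m -> J p q n ->
  lside m -> lside n.
Proof.
move=> Pp Pq pq pqm pqn; apply: side_conn; apply: sub_conn (J_conn pq pqm pqn).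
move=> s t [st js jt]; split=> //.
by case=> -[? ?]; subst; apply: Pq; apply: (P0_step Pp).
Qed.

(** [P0] is connected by [conn_cap], so a second exit edge would close a cycle. *)
Let exit_uniq p q u v : P0 p -> ~ P0 q -> adj p q -> P0 u -> adj u v ->
  conn (fun s t => [/\ adj s t, ~ P0 s & ~ P0 t]) q v -> p = u /\ q = v.
Proof.
move=> Pp Pq pq Pu uv qv.
have [e|ne] := pselect (is_edge p q u v).
  by case: e => -[eu ev] //; case: Pq; rewrite -eu.
case: (Vt.2 _ _ pq).
have pu : conn (cut adj p q) p u.
  have vp m := conn_sym (@lvl_sym m); have [kp lp] := Pp; have [ku lu] := Pu.
  have := conn_cap Vt (@lvl_adj k) (@lvl_sym k) (@lvl_adj l) (@lvl_sym l) (Vconn p u)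
    (conn_trans (vp _ _ _ kp) ku)
    (conn_trans (vp _ _ _ lp) lu).
  apply: sub_conn => s t [kst lst]; split; first exact: kst.1.
  case=> -[es et]; subst; apply: Pq; first exact: P0_step kst lst.
  by apply: (P0_step Pp); apply: lvl_sym.
have cuv : cut adj p q u v by [].
apply: conn_trans (connS pu cuv) _; apply: (conn_sym (cut_sym Vt (u := p) (v := q))).
by apply: sub_conn qv => s t [st Ps Pt]; split=> // -[[es _]|[_ et]]; subst.
Qed.

Let side_of_horizontal v w m : adj v w -> J v w m -> side_of v m -> side_of w m.
Proof.
move=> vw jm [[Pv sm]|[Pv [p [q [n [[Pp Pq] pq qv pqn sn]]]]]].
  have [Pw|Pw] := pselect (P0 w); first by left.
  by right; split=> //; exists v, w, m; split=> //; apply: conn0.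
have [Pw|Pw] := pselect (P0 w); last first.
  right; split=> //; exists p, q, n; split=> //.
  by apply: connS qv _; split.
left; split=> //; have wv := Vt.1 _ _ vw.
have [ep eq] := exit_uniq Pp Pq pq Pw wv qv; subst p q.
by apply: exit_const pqn (JC jm) sn.
Qed.

Let side_of_comp v w m : lcomp m v = lcomp m w -> side_of v m -> side_of w m.
Proof.
move=> /lcomp_eq; elim=> // x y _ IH [xy jxy] /IH.
exact: side_of_horizontal.
Qed.

Let side_of_vertical v m n : ladj m n -> (P0 v -> ~ is_edge k l m n) ->
  side_of v m -> side_of v n.
Proof.
move=> mn ne [[Pv sm]|[Pv H]]; last by right.
by left; split=> //; apply: connS sm _; split=> //; apply: ne.
Qed.

Lemma tadj_bridge :
  ~ conn (cut tadj (k, lcomp k v0) (l, lcomp l v0)) (k, lcomp k v0) (l, lcomp l v0).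
Proof.
set x := (k, _); set y := (l, _) => xy.
have P00 : P0 v0 by split; apply: conn0.
suff : forall v, y.2 = lcomp y.1 v -> ~ side_of v y.1.
  by move=> /(_ v0 erefl); apply; left; split=> //; apply: side_refl.
apply: (conn_inv (P := fun z => forall v, z.2 = lcomp z.1 v -> ~ side_of v z.1)) xy _.
  move=> z z' [[zz' [w [zw z'w]]] nxy] IH v z'v sv.
  apply: (IH w zw); have := side_of_comp (etrans (esym z'v) z'w) sv.
  apply: side_of_vertical; first exact: Lt.1.
  move=> [kw lw] e; apply: nxy.
  have ek : lcomp k v0 = lcomp k w by apply/lcomp_eq.
  have el : lcomp l v0 = lcomp l w by apply/lcomp_eq.
  case: z z' zz' zw z'w e {IH z'v sv} => [m Q] [m' Q'] /= _ -> -> [[-> ->]|[-> ->]].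
    by right; rewrite /x /y ek el.
  by left; rewrite /x /y ek el.
move=> v /= e sv.
have := side_of_comp (esym e) sv; case=> [[_]|[]//].
exact: (sideN Lt kl).
Qed.

End Cut.

Theorem tadj_bridged : bridged tadj.
Proof.
split=> [x y [xy [v [ex ey]]]|[k P] [l Q] [/= kl [v [-> ->]]]].
  by split; [apply: Lt.1|exists v].
exact: tadj_bridge.
Qed.

Hypothesis J_ne : forall u v, adj u v -> exists l, J u v l.

(** The copies of [Lam] over the ends of an edge meet, as [J] is nonempty there. *)
Lemma tadj_conn k l u v : conn tadj (k, lcomp k u) (l, lcomp l v).
Proof.
have vert w m n : conn tadj (m, lcomp m w) (n, lcomp n w).
  apply: (conn_map (h := fun m => (m, lcomp m w))) (Lconn m n) => s t st.
  by apply: conn1; split=> //; exists w.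
elim: (Vconn u v) l => [//|x y _ IH xy] l.
have [m jm] := J_ne xy; apply: conn_trans (vert y m l).
suff <- : lcomp m x = lcomp m y by [].
by apply/lcomp_eq/conn1.
Qed.

Section TreeAction.
Variables (F : groupType) (vact : F -> V -> V) (lact : F -> Lam -> Lam).
Hypothesis vactP : is_left_action vact.
Hypothesis lactP : is_left_action lact.

Definition tact (f : F) (x : Lam * set V) : Lam * set V :=
  (lact f x.1, vact f @` x.2).

Lemma tactP : is_left_action tact.
Proof.
split=> [[l P]|f g [l P]]; rewrite /tact /= ?lactP.1 ?lactP.2; congr pair.
  apply/seteqP; split=> v /= => [[w Pw]|Pv]; first by rewrite vactP.1 => <-.
  by exists v => //; rewrite vactP.1.
apply/seteqP; split=> v /= [w Pw <-]; first by exists (vact g w); [exists w|rewrite vactP.2].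
by case: Pw => u Pu <-; exists u; rewrite ?vactP.2.
Qed.

Variable G : set F.
Hypothesis G_sg : is_subgroup G.
Hypothesis vact_adj : forall f u v, adj u v -> adj (vact f u) (vact f v).
Hypothesis lact_adj : forall f k l, G f -> ladj k l -> ladj (lact f k) (lact f l).
Hypothesis J_act : forall f u v l, G f -> J u v l ->
  J (vact f u) (vact f v) (lact f l).

Lemma lcomp_act f l v : G f -> vact f @` lcomp l v = lcomp (lact f l) (vact f v).
Proof.
have sub g m x : G g -> vact g @` lcomp m x `<=` lcomp (lact g m) (vact g x).
  move=> Gg w [u mu <-]; apply: (conn_map (h := vact g)) mu => s t [st jst].
  by apply: conn1; split; [apply: vact_adj|apply: J_act].
move=> Gf; apply/seteqP; split; first exact: sub.
move=> w cw; have Gfi := sgV G_sg Gf.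
have := sub _ (lact f l) (vact f v) Gfi (vact f^-1 w); rewrite !actK // => H.
exists (vact f^-1 w); last by rewrite actVK.
by apply: H; exists w.
Qed.

Lemma tact_adj f x y : G f -> tadj x y -> tadj (tact f x) (tact f y).
Proof.
move=> Gf [xy [v [ex ey]]]; split; first exact: lact_adj.
by exists (vact f v); rewrite /= ex ey !lcomp_act.
Qed.

End TreeAction.

End TreeOfTrees.

(** * Hyperbolic elements through half-trees *)

Section Hyperbolic.
Variables (F : groupType) (V : Type) (act : F -> V -> V) (adj : V -> V -> Prop).
Hypothesis actP : is_left_action act.
Hypothesis Vt : bridged adj.
Hypothesis Vconn : forall u v, conn adj u v.
Hypothesis act_adj : forall f u v, adj u v -> adj (act f u) (act f v).

Lemma conn_cut_act f x y u v : conn (cut adj x y) u v ->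
  conn (cut adj (act f x) (act f y)) (act f u) (act f v).
Proof.
apply: (conn_map (h := act f)) => s t [st ne]; apply: conn1; split.
  exact: act_adj.
by case=> -[/(act_inj actP) es /(act_inj actP) et]; apply: ne; [left|right].
Qed.

Lemma side_act f x y u : side adj x y u -> side adj (act f x) (act f y) (act f u).
Proof. exact: conn_cut_act. Qed.

Lemma sep_act f x y u v : sep adj x y u v ->
  sep adj (act f x) (act f y) (act f u) (act f v).
Proof. by move=> s /(conn_cut_act f^-1); rewrite !actK. Qed.

Variables (a b : V) (g : F).
Hypothesis ab : adj a b.
Let S := side adj a b.
Hypothesis Sg : forall x, S x -> S (act g x).
Variable p : V.
Hypothesis Sp : S p.
Hypothesis gSp : ~ S (act g^-1 p).

Let gab : ~ (act g a = a /\ act g b = b).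
Proof.
case=> ga gb; apply: gSp; have := side_act g^-1 Sp.
by rewrite -{1}ga -{1}gb !actK.
Qed.

(** An induction along a path from [p] is obstructed only when a translated edge is [a b] itself;
    one more translation resolves this, as [g] does not fix that edge. The same holds for
    [halfspace_enter]. *)
Lemma halfspace_escape v : exists n, ~ S (act (g ^+ n)^-1 v).
Proof.
elim: (Vconn p v) => [|y z _ [n nS] yz]; first by exists 1%N; rewrite expg1.
have [Sz|] := pselect (S (act (g ^+ n)^-1 z)); last by exists n.
exists n.+1; rewrite expgSr invgM actM //.
have [-> ey] := side_step (act_adj (g ^+ n)^-1 (Vt.1 _ _ yz)) Sz nS.
move=> Sgb; have Sga : ~ S (act g^-1 a).
  by move=> /Sg; rewrite actVK //; apply: sideN.
have [eb ea] := side_step (act_adj g^-1 (Vt.1 _ _ ab)) Sgb Sga.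
by apply: gab; rewrite -{1}ea -{1}eb !actVK.
Qed.

Lemma halfspace_enter v : exists n, S (act (g ^+ n) v).
Proof.
elim: (Vconn p v) => [|y z _ [n Sn] yz]; first by exists 0%N; rewrite act1.
have [|nSz] := pselect (S (act (g ^+ n) z)); first by exists n.
exists n.+1; rewrite expgS actM //.
have [ey ->] := side_step (act_adj (g ^+ n) yz) Sn nSz.
apply: contrapT => nSga.
have := Sg (side_refl adj a b); move=> Sgb.
have [eb ea] := side_step (act_adj g (Vt.1 _ _ ab)) Sgb nSga.
exact: gab.
Qed.

(** Membership in [S] is constant along [E]. If [g ^+ j] preserved an [E]-component for some
    positive [j], a translate of [v] would stay outside [S] under all multiples of [j], while every
    forward orbit ends up in [S]. *)
Lemma hyperbolic (E : V -> V -> Prop) v j :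
  (forall x y, E x y -> E (act g x) (act g y)) ->
  (forall x y, E x y -> E (act g^-1 x) (act g^-1 y)) ->
  (forall x y, E x y -> cut adj a b x y) ->
  conn E v (act (g ^+ j) v) -> j = 0%N.
Proof.
move=> Eg Egi Ecut vj; case: j vj => // j vj; exfalso.
have EX n x y : conn E x y -> conn E (act (g ^+ n) x) (act (g ^+ n) y).
  elim: n x y => [|n IH] x y; first by rewrite !act1.
  move=> /IH; rewrite !expgS !actM //.
  by apply: (conn_map (h := act g)) => s t st; apply/conn1/Eg.
have EXi n x y : conn E x y -> conn E (act (g ^+ n)^-1 x) (act (g ^+ n)^-1 y).
  elim: n x y => [|n IH] x y; first by rewrite expg0 invg1 !act1.
  move=> /IH; rewrite !expgSr !invgM !actM //.
  by apply: (conn_map (h := act g^-1)) => s t st; apply/conn1/Egi.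
have [i nS] := halfspace_escape v; set x := act _ v in nS.
have xj : conn E x (act (g ^+ j.+1) x).
  have := EXi i _ _ vj; rewrite -!actM // (_ : _ * _ = g ^+ j.+1 * (g ^+ i)^-1) //.
  exact/esym/commuteV/commuteX2.
have [m Sm] := halfspace_enter x.
have mono n : S (act (g ^+ (m + n)) x).
  by elim: n => [|n IH]; rewrite ?addn0 // addnS expgS actM //; apply: Sg.
suff per n : ~ S (act (g ^+ (n * j.+1)) x).
  by apply: (per m); rewrite mulnS; apply: mono.
elim: n => [|n IH]; first by rewrite act1.
rewrite mulSn addnC expgnDr actM //.
have := sub_conn Ecut (EX (n * j.+1)%N _ _ xj).
by move=> /(side_conn_eq Vt) H /H.
Qed.

End Hyperbolic.

(** * Whitehead sets *)

Section Whitehead.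
Variable F : groupType.
Implicit Types (g r : F) (H Y : set F).

Lemma generated0 n : generated (set0 : set F) n -> n = 1.
Proof.
apply: (@generated_min _ _ [set 1]); last by move=> ?.
by split=> // x y -> ->; rewrite /= mulgV.
Qed.

Lemma Wh_set0 : Wh (set0 : set F).
Proof.
exists set0; split=> // K f; exists (fun _ => 1); split=> // x y _ _.
by rewrite mulg1.
Qed.

Lemma conjVM g (x y : F) : g^-1 * (x * y) * g = (g^-1 * x * g) * (g^-1 * y * g).
Proof. by rewrite !mulgA mulgK. Qed.

Lemma conj_setE g Y x : conj_set g Y (g * x * g^-1) = Y x.
Proof. by rewrite /conj_set /= !mulgA mulVg mul1g mulgVK. Qed.

Lemma Wh_conj g Y : Wh Y -> Wh (conj_set g Y).
Proof.
case=> X [XY fX YX XC]; exists (conj_set g X); split=> [x /XY //|||].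
- move=> K f; have [phi [phom phiP]] := fX K (fun x => f (g * x * g^-1)).
  exists (fun x => phi (g^-1 * x * g)); rewrite generated_conj_set; split.
    by move=> x y gx gy; rewrite conjVM phom.
  by move=> x Xx; rewrite phiP // !mulgA mulgV mul1g mulgK.
- by move=> y Yy; rewrite generated_conj_set; apply: YX.
- move=> y Yy; have [n [Yn Xn]] := XC _ Yy; exists (g * n * g^-1).
  rewrite generated_conj_set conj_setE; split=> //.
  move: Xn; rewrite /conj_set /= !invgM invgK.
  by rewrite !mulgA mulVg mul1g !mulgVK.
Qed.

Lemma expg_ratio (K : groupType) (x : K) i j i' j' :
  x ^+ i / x ^+ j * (x ^+ i' / x ^+ j') = x ^+ (i + i') / x ^+ (j + j').
Proof.
rewrite !expgnDr invgM -!mulgA; congr (_ * _); rewrite !mulgA.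
have c : commute (x ^+ i') (x ^+ j)^-1 by apply/commuteV/commuteX2.
rewrite -c -!mulgA; congr (_ * _); rewrite -!invgM; congr (_^-1).
exact: commuteX2.
Qed.

(** Exponents are natural numbers, so an integral power is written as a quotient of two powers. *)
Lemma cyclicP r n : generated [set r] n -> exists i j, n = r ^+ i / r ^+ j.
Proof.
apply: (@generated_min _ _ [set n | exists i j, n = r ^+ i / r ^+ j]).
  apply: is_subgroupI => [|x [i [j ->]]|x y [i [j ->]] [i' [j' ->]]].
  - by exists 0%N, 0%N; rewrite mulgV.
  - by exists j, i; rewrite invgF.
  - by exists (i + i')%N, (j + j')%N; rewrite expg_ratio.
by move=> _ ->; exists 1%N, 0%N; rewrite expg1 expg0 invg1 mulg1.
Qed.

Lemma expg_eq_inf r i j : (forall n, r ^+ n = 1 -> n = 0%N) ->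
  r ^+ i = r ^+ j -> i = j.
Proof.
move=> inf; wlog ij : i j / (i <= j)%N.
  by move=> H; case: (leqP i j) => [/H//|/ltnW/H + /esym] => /[apply].
move=> e; apply/eqP; rewrite eqn_leq ij -subn_eq0; apply/eqP/inf.
by rewrite expgnFr // e mulgV.
Qed.

Lemma Wh_cyclic r : (forall n, r ^+ n = 1 -> n = 0%N) -> Wh [set r].
Proof.
move=> inf; exists [set r]; split=> // [K f||].
- pose Gam x (k : K) := exists i j, x = r ^+ i / r ^+ j /\ k = f r ^+ i / f r ^+ j.
  have [] := @hom_of_rel _ K (generated [set r]) Gam (is_subgroup_generated _).
  + by move=> x /cyclicP[i [j ->]]; exists (f r ^+ i / f r ^+ j), i, j.
  + move=> x k y m [i [j [-> ->]]] [i' [j' [-> ->]]].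
    by exists (i + i')%N, (j + j')%N; rewrite !expg_ratio.
  + by move=> x k [i [j [-> ->]]]; exists j, i; rewrite !invgF.
  + move=> k [i [j [/esym/divg1_eq e ->]]].
    by rewrite (expg_eq_inf inf e) mulgV.
  move=> phi [phom phiP]; exists phi; split=> // _ ->.
  by apply: phiP; exists 1%N, 0%N; rewrite !expg1 !expg0 !invg1 !mulg1.
- by move=> y ->; apply: mem_generated.
- by move=> y ->; exists 1; rewrite mul1g invg1 mulg1; split=> //; case: (is_subgroup_generated [set r]).
Qed.

Definition rel_conj H r : set F := [set y | exists2 h, H h & y = h * r * h^-1].

Lemma generated_rel_conj H K r : is_subgroup H -> H `<=` K -> is_subgroup K -> K r ->
  generated (rel_conj H r) `<=` K.
Proof.
move=> Hsg HK Ksg Kr; apply: generated_min => // _ [h /HK Kh ->].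
by apply: (sgM Ksg); [apply: (sgM Ksg)|apply: (sgV Ksg)].
Qed.

End Whitehead.

(** * Two index trees: the star and the integer line *)

Section Star.
Variable T : Type.

Definition star (x y : option T) := (x = None /\ y <> None) \/ (y = None /\ x <> None).

Lemma star_bridged : bridged star.
Proof.
split=> [u v [[]|[]]|u v]; [by right|by left|].
case=> -[-> nN] uv.
  have : v <> v; last by [].
  apply: (conn_inv (P := fun z => z <> v)) uv (nesym nN).
  move=> s t [st ne] sv tv; apply: ne; left; split=> //.
  by case: st => -[] //; rewrite tv.
have : None = u; last by move/esym.
apply: (conn_inv (P := fun z => z = u)) uv erefl.
move=> s t [st ne] su; case: ne; left; split=> //.
by case: st => -[] //; rewrite su.
Qed.

Lemma star_conn k l : conn star k l.
Proof.
have H z : conn star z None.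
  by case: z => [z|]; [apply: conn1; right|apply: conn0].
by apply: conn_trans (H k) (conn_sym star_bridged.1 (H l)).
Qed.

End Star.

Section Line.
Local Open Scope Z_scope.

Definition line (k l : Z) := l = k + 1 \/ k = l + 1.

Lemma line_bridged : bridged line.
Proof.
split=> [u v [->|->]|u v uv c]; [by right|by left|].
have lem : forall z, conn (cut line u v) u z ->
    (v = u + 1 -> z <= u) /\ (u = v + 1 -> u <= z).
  move=> z; elim=> [|s t _ [IH1 IH2] [st ne]]; first by split; lia.
  split=> e; [have := IH1 e|have := IH2 e] => h.
    have [et|] : t <= u \/ s = u /\ t = v by case: st; lia.
      by [].
    by move=> est; case: ne; left.
  have [et|] : u <= t \/ s = u /\ t = v by case: st; lia.
    by [].
  by move=> est; case: ne; left.
by have [] := lem v c; case: uv => uv; lia.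
Qed.

Lemma line_interval k l :
  conn (fun s t => [/\ line s t, (k <= s <= l \/ l <= s <= k) &
                              (k <= t <= l \/ l <= t <= k)]) k l.
Proof.
have up n : forall k l, l = k + Z.of_nat n -> conn (fun s t => [/\ line s t,
    (k <= s <= l \/ l <= s <= k) & (k <= t <= l \/ l <= t <= k)]) k l.
  elim: n => [|n IH] x y e.
    have -> : y = x by lia.
    exact: conn0.
  have c := IH x (y - 1) ltac:(lia).
  have step : line (y - 1) y by left; lia.
  apply: connS (sub_conn _ c) _; last by split=> //; lia.
  by move=> s t [st sx tx]; split=> //; lia.
have [kl|lk] := Z.le_ge_cases k l.
  by apply: (up (Z.to_nat (l - k))); lia.
have c := up (Z.to_nat (k - l)) l k ltac:(lia).
apply: sub_conn (conn_sym _ c); first by move=> s t [st ? ?]; split=> //; lia.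
by move=> s t [[]]; split=> //; [right|left].
Qed.

Lemma line_conn k l : conn line k l.
Proof. by apply: sub_conn (line_interval k l) => s t []. Qed.

End Line.

(** * Homomorphisms to the integers *)

Section Indicable.

Definition zhom_on (F : groupType) (A : set F) (phi : F -> Z) :=
  forall f g, A f -> A g -> phi (f * g) = (phi f + phi g)%Z.

Lemma zhom_on1 (F : groupType) (A : set F) phi : is_subgroup A -> zhom_on A phi ->
  phi 1 = 0%Z.
Proof. by move=> /sg1 A1 /(_ _ _ A1 A1); rewrite mul1g; lia. Qed.

Lemma zhom_on_ker (F : groupType) (A : set F) phi : is_subgroup A -> zhom_on A phi ->
  is_subgroup [set f | A f /\ phi f = 0%Z].
Proof.
move=> Asg hphi; apply: is_subgroupI => /= [|x [Ax ex]|x y [Ax ex] [Ay ey]].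
- by split; [apply: (sg1 Asg)|apply: zhom_on1 Asg hphi].
- split; first exact: (sgV Asg).
  have := hphi _ _ (sgV Asg Ax) Ax; rewrite mulVg (zhom_on1 Asg hphi); lia.
- by split; [apply: (sgM Asg)|rewrite hphi // ex ey].
Qed.

Lemma infinite_cyclic_gen (Q : groupType) (g : Q) : infinite_set [set: Q] ->
  generated [set g] = [set: Q] -> forall n, g ^+ n = 1 -> n = 0%N.
Proof.
move=> Qinf gQ [//|n] gn; exfalso; apply: Qinf.
apply: (@sub_finite_set _ _ ((fun i => g ^+ i) @` `I_n.+1)); last first.
  exact/finite_image/finite_II.
move=> x _; have : generated [set g] x by rewrite gQ.
(* Here [g^-1] equals [g ^+ n], whence the exponent [i + j * n]. *)
move=> /cyclicP[i [j ->]]; exists ((i + j * n) %% n.+1)%N; first by rewrite /= ltn_mod.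
have gm k : g ^+ (n.+1 * k) = 1 by rewrite expgnA gn expg1n.
rewrite /= -[RHS]mulg1 -(gm j) mulSn expgnDr mulgA mulgVK -expgnDr [(n * j)%N]mulnC.
by rewrite {2}(divn_eq (i + j * n) n.+1) expgnDr [(_ * n.+1)%N]mulnC gm mul1g.
Qed.

Lemma infinite_cyclic_Z (Q : groupType) : infinite_cyclic Q ->
  exists theta : Q -> Z, zhom_on [set: Q] theta /\ forall x, theta x = 0%Z -> x = 1.
Proof.
case=> Qinf [g gQ]; have inf := infinite_cyclic_gen Qinf gQ.
pose rel x z := exists i j, x = g ^+ i / g ^+ j /\ z = (Z.of_nat i - Z.of_nat j)%Z.
have uniq x z z' : rel x z -> rel x z' -> z = z'.
  case=> i [j [-> ->]] [i' [j' [e ->]]].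
  have : g ^+ (i + j') = g ^+ (i' + j).
    rewrite !expgnDr -[g ^+ i](mulgVK (g ^+ j)) e -!mulgA; congr (_ * _).
    have c : commute (g ^+ j') (g ^+ j) by apply: commuteX2.
    by rewrite -c mulKg.
  by move=> /(expg_eq_inf inf); rewrite -!plusE; lia.
have /choice[theta thetaP] x : exists z, rel x z.
  have : generated [set g] x by rewrite gQ.
  by move=> /cyclicP[i [j ->]]; exists (Z.of_nat i - Z.of_nat j)%Z, i, j.
exists theta; split=> [x y _ _|x e].
  apply: uniq (thetaP _) _; have [i [j [ex ->]]] := thetaP x.
  have [i' [j' [ey ->]]] := thetaP y; exists (i + i')%N, (j + j')%N.
  by rewrite ex ey expg_ratio -!plusE; split=> //; lia.
have [i [j [ex e']]] := thetaP x; rewrite ex; have -> : i = j by lia.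
exact: mulgV.
Qed.

Variables (F : groupType) (W : Type) (act : F -> W -> W).
Hypothesis F_li : locally_indicable F.
Hypothesis actP : is_left_action act.
Variable adj : W -> W -> Prop.
Hypothesis Wt : bridged adj.
Variable G : set F.
Hypothesis G_sg : is_subgroup G.
Hypothesis G_adj : forall g x y, G g -> adj x y -> adj (act g x) (act g y).
Variable Ng : W -> set F.
Hypothesis Ng_sg : forall w, is_subgroup (Ng w).
Hypothesis Ng_sub : forall w, Ng w `<=` G.
Hypothesis Ng_fix : forall w n, Ng w n -> act n w = w.
Variable D : set W.
Hypothesis D_conn : forall x y, D x -> D y ->
  conn (fun s t => [/\ adj s t, D s & D t]) x y.
Hypothesis D_free : forall x u v n, D x -> D u -> D v -> adj x u -> adj x v ->
  Ng x n -> act n u = v -> n = 1.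
Hypothesis G_words : G `<=` word_group Ng D.
Variable s : seq F.
Hypothesis G_fg : G `<=` generated [set` s].
Hypothesis Gs : [set` s] `<=` G.

(** Killing the other factors retracts [G] onto [Ng x], which is therefore finitely generated; local
    indicability then maps it onto an infinite cyclic group. *)
Lemma factor_hom x n : D x -> Ng x n -> n <> 1 -> exists psi : F -> Z,
  [/\ zhom_on G psi, exists2 m, Ng x m & psi m <> 0%Z &
     forall y m, D y -> y <> x -> Ng y m -> psi m = 0%Z].
Proof.
move=> Dx nx n1; pose alpha w (k : F) : F := if `[< w = x >] then k else 1.
have ax k : alpha x k = k by rewrite /alpha asboolT.
have ha w : D w -> hom_on (Ng w) (alpha w).
  by move=> _ k l _ _; rewrite /alpha; case: asboolP => // _; rewrite mulg1.
have [rho [rhoM rhoP]] := word_group_hom actP Wt G_adj Ng_sg Ng_sub Ng_fix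
  D_conn D_free ha.
have Wsg : is_subgroup (word_group Ng D) by apply: is_subgroup_generated.
have rhox k : word_group Ng D k -> Ng x (rho k).
  move=> Wk; suff [] : (word_group Ng D k /\ Ng x (rho k)) by [].
  apply: (@generated_min _ _ [set k | word_group Ng D k /\ Ng x (rho k)]) Wk.
    apply: is_subgroupI => /= [|y [Wy ny]|y z [Wy ny] [Wz nz]].
    - by rewrite (hom_on1 Wsg rhoM); split; [apply: (sg1 Wsg)|apply: (sg1 (Ng_sg x))].
    - by rewrite (hom_onV Wsg rhoM Wy); split; [apply: (sgV Wsg)|apply: (sgV (Ng_sg x))].
    - by rewrite rhoM //; split; [apply: (sgM Wsg)|apply: (sgM (Ng_sg x))].
  move=> y [w Dw ny]; split; first by apply: mem_generated; exists w.
  rewrite (rhoP w) // /alpha; case: asboolP => [e|_]; first by rewrite -e.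
  exact: (sg1 (Ng_sg x)).
pose A := Subgroup (Ng_sg x).
have /choice[h hP] f : exists a : A, word_group Ng D f -> val a = rho f.
  have [Wf|nW] := pselect (word_group Ng D f); last by exists 1.
  by exists (SubgroupElt (H := A) (mem_set (rhox _ Wf))).
have hM f g : G f -> G g -> h (f * g) = h f * h g.
  move=> /G_words Wf /G_words Wg; apply: val_inj; rewrite valM !hP //.
    by rewrite rhoM.
  exact: (sgM Wsg).
have hval (a : A) : h (val a) = a.
  have na : Ng x (val a) by case: a => a /= /set_mem.
  have Wa : word_group Ng D (val a) by apply: G_words; apply: Ng_sub na.
  by apply: val_inj; rewrite hP // (rhoP x) // ax.
have Gval (a : A) : G (val a) by case: a => a /= /set_mem; apply: Ng_sub.
have Afg : finitely_generable A.
  exists (h @` [set` s]); split; first exact/finite_image/finite_seq.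
  apply/seteqP; split=> // a _; rewrite -[a]hval.
  have sgA := is_subgroup_generated (h @` [set` s]).
  suff [] : (G (val a) /\ generated (h @` [set` s]) (h (val a))) by [].
  apply: (@generated_min _ _ [set f | G f /\ generated (h @` [set` s]) (h f)]) (G_fg (Gval a)).
    apply: is_subgroupI => /= [|f [Gf hf]|f g [Gf hf] [Gg hg]].
    - split; first exact: (sg1 G_sg).
      have e : h 1 = h 1 * h 1 by rewrite -hM ?mulg1 //; apply: (sg1 G_sg).
      have -> : h 1 = 1 by apply: (mulgI (h 1)); rewrite mulg1 -e.
      exact: (sg1 sgA).
    - split; first exact: (sgV G_sg).
      have e1 : h 1 = 1.
        have e : h 1 = h 1 * h 1 by rewrite -hM ?mulg1 //; apply: (sg1 G_sg).
        by apply: (mulgI (h 1)); rewrite mulg1 -e.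
      have -> : h f^-1 = (h f)^-1.
        by apply/esym/mulg1_eq; rewrite -hM ?mulgV //; apply: (sgV G_sg).
      exact: (sgV sgA).
    - by rewrite hM //; split; [apply: (sgM G_sg)|apply: (sgM sgA)].
  move=> f sf; split; first by apply: Gs.
  by apply: mem_generated; exists f.
have [A1|[Q [q [qQ Qcyc]]]] := F_li Afg.
  case: n1; pose a : A := SubgroupElt (H := A) (mem_set nx).
  by have : [set: A] a by []; rewrite A1 => /(congr1 val).
have [theta [thetaM theta0]] := infinite_cyclic_Z Qcyc.
exists (fun f => theta (q (h f))); split.
- by move=> f g Gf Gg; rewrite hM // gmulfM thetaM.
- have [z z1] : exists z : Q, z <> 1.
    apply: contrapT => no; apply: Qcyc.1; apply: (@sub_finite_set _ _ [set 1]).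
      by move=> z _; apply: contrapT => z1; apply: no; exists z.
    exact: finite_set1.
  have [a _ qa] : range q z by rewrite qQ.
  exists (val a); first by case: a {qa} => a /= /set_mem.
  by rewrite hval qa => /theta0.
- move=> y m Dy yx ny.
  have Wm : word_group Ng D m by apply: G_words; apply: Ng_sub ny.
  have -> : h m = 1.
    apply: val_inj; rewrite hP // (rhoP y) // /alpha asboolF //.
  have -> : q 1 = 1.
    by apply: (mulgI (q 1)); rewrite -gmulfM !mulg1.
  by apply: zhom_on1 thetaM; split.
Qed.

Lemma two_factor_hom x y m n r : G r -> D x -> D y -> x <> y ->
  Ng x m -> m <> 1 -> Ng y n -> n <> 1 -> exists phi : F -> Z,
  [/\ zhom_on G phi, phi r = 0%Z & exists2 f, G f & phi f <> 0%Z].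
Proof.
move=> Gr Dx Dy xy mx m1 ny n1.
have [al [alM [m' mx' am'] aly]] := factor_hom Dx mx m1.
have [be [beM [n' ny' bn'] bex]] := factor_hom Dy ny n1.
have bm' : be m' = 0%Z by apply: bex Dx xy mx'.
have an' : al n' = 0%Z by apply: aly Dy (nesym xy) ny'.
have [Gm' Gn'] := (Ng_sub mx', Ng_sub ny').
have [e|e] := pselect (al r = 0%Z /\ be r = 0%Z).
  by exists al; split=> //; [exact: e.1|exists m'].
(* This combination kills [r]. It vanishes on both factors only if [al r] and [be r] are both zero,
   the case already settled. *)
exists (fun f => be r * al f - al r * be f)%Z; split.
- by move=> f g Gf Gg; rewrite alM // beM //; lia.
- lia.
- have [e'|e'] := pselect (be r = 0%Z); last by exists m' => //; rewrite bm'; nia.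
  by exists n' => //; rewrite an' e'; nia.
Qed.

End Indicable.

(** * Induction on relators *)

Section FreeTree.
Variables (F : groupType) (V : Type) (act : F -> V -> V) (adj : V -> V -> Prop).
Hypothesis actP : is_left_action act.
Hypothesis Vt : bridged adj.
Hypothesis Vconn : forall u v, conn adj u v.
Hypothesis act_adj : forall f u v, adj u v -> adj (act f u) (act f v).
Hypothesis act_free : forall f u v, adj u v -> act f u = u -> act f v = v -> f = 1.
Hypothesis act_noinv : forall f u v, adj u v -> act f u = v -> act f v = u -> False.

Section Edge.
Variables (a b : V).
Hypothesis ab : adj a b.

Definition edge_at (f : F) (u v : V) := is_edge (act f a) (act f b) u v.

Lemma edge_at_act f g u v : edge_at f (act g u) (act g v) -> edge_at (g^-1 * f) u v.
Proof.
by case=> -[e1 e2]; [left|right]; rewrite !actP.2 -e1 -e2 !actK.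
Qed.

Lemma edge_atC f u v : edge_at f u v -> edge_at f v u.
Proof. exact: is_edgeC. Qed.

(** Two elements taking [a b] to the same edge differ by an element that fixes or inverts an
    edge. *)
Lemma edge_at_uniq f g u v : edge_at f u v -> edge_at g u v -> f = g.
Proof.
have key h k : act h a = act k a -> act h b = act k b -> h = k.
  move=> ea eb; apply/esym; apply: divg1_eq; apply: (@act_free (k / h) (act h a) (act h b)).
  - exact: act_adj.
  - by rewrite actP.2 actK // -ea.
  - by rewrite actP.2 actK // -eb.
have key' h k : act h a = act k b -> act h b = act k a -> h = k.
  move=> ea eb; exfalso; apply: (@act_noinv (k / h) (act h a) (act h b)).
  - exact: act_adj.
  - by rewrite actP.2 actK.
  - by rewrite actP.2 actK.
case=> -[-> ->] [] [ea eb]; [exact: key|exact: key'| |].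
  by apply: key'.
by apply: key.
Qed.

(** The forest whose components the Freiheitssatz is about. *)
Definition dead (H : set F) (u v : V) := adj u v /\ forall f, H f -> ~ edge_at f u v.

Lemma dead_sym H u v : dead H u v -> dead H v u.
Proof. by case=> /Vt.1 vu nH; split=> // f /nH n /edge_atC. Qed.

Lemma dead_act (H : set F) h u v : is_subgroup H -> H h -> dead H u v ->
  dead H (act h u) (act h v).
Proof.
move=> Hsg Hh [uv nH]; split; first exact: act_adj.
by move=> f Hf /edge_at_act; apply: nH; apply: (sgM Hsg) => //; apply: (sgV Hsg).
Qed.

Lemma dead_cut (H : set F) f u v : H f -> dead H u v ->
  cut adj (act f a) (act f b) u v.
Proof. by move=> Hf [uv nH]; split=> //; apply: nH. Qed.

Definition esep u v f := sep adj (act f a) (act f b) u v.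

Lemma esep_edge_at f p q u v : edge_at f p q -> sep adj p q u v -> esep u v f.
Proof. by case=> -[-> ->] // s; apply: sepC. Qed.

Lemma esep_act g f u v : esep (act g u) (act g v) f -> esep u v (g^-1 * f).
Proof.
move=> /(@sep_act _ _ _ _ actP act_adj g^-1 _ _ _ _).
by rewrite /esep !actP.2 !actK.
Qed.

Lemma finite_esep u v : exists s : seq F, forall f, esep u v f -> f \in s.
Proof.
elim: (Vconn u v) => [|y z _ [s sP] yz].
  by exists [::] => f sf; case: sf; apply: conn0.
have [[f0 e0]|no] := pselect (exists f, edge_at f y z); last first.
  exists s => f sf; apply: sP => c; apply: sf; apply: connS c _; split=> //.
  by move=> e; apply: no; exists f.
exists (f0 :: s) => f sf; rewrite inE; have [e|ne] := pselect (edge_at f y z).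
  by rewrite (edge_at_uniq e e0) eqxx.
by rewrite sP ?orbT // => c; apply: sf; apply: connS c _; split.
Qed.

End Edge.

(** No backtracking at [act r v0]: the translates of the segment from [v0] to [act r v0] line up
    along an axis. *)
Definition on_axis (r : F) (v0 : V) := forall x y, adj x y ->
  sep adj x y v0 (act r v0) -> sep adj x y (act r v0) (act r (act r v0)) -> False.

Lemma on_axis_conj f r v0 : on_axis r v0 -> on_axis (f * r * f^-1) (act f v0).
Proof.
have e v : act (f * r * f^-1) (act f v) = act f (act r v).
  by rewrite !actP.2 actK.
move=> ax x y xy; rewrite !e.
move=> /(@sep_act _ _ _ _ actP act_adj f^-1 _ _ _ _) + /(@sep_act _ _ _ _ actP act_adj f^-1 _ _ _ _).
by rewrite !actK //; apply: ax; apply: act_adj.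
Qed.

Lemma conn_cut_or (R : V -> V -> Prop) a b u w : (forall s t, R s t -> adj s t) ->
  conn R u w -> conn (cut adj a b) u w \/ conn R u a.
Proof.
move=> Radj; elim=> [|s t us [IH|] st]; [by left; apply: conn0| |by right].
have [[[es _]|[_ et]]|ne] := pselect (is_edge a b s t).
- by right; rewrite -es.
- by right; rewrite -et; apply: connS us st.
- by left; apply: connS IH _; split=> //; apply: Radj.
Qed.

Lemma cut_adj x y u v : cut adj x y u v -> adj u v.
Proof. by case. Qed.

(** By [ax] the translated edge does not separate [v0] from [act r v0], so that segment, and with it
    [a], lies outside the translated half-tree. A path inside the translated half-tree thus never
    meets [a], hence never crosses [a b]. *)
Lemma axis_side r v0 a b : on_axis r v0 -> adj a b -> ~ side adj a b v0 ->
  side adj a b (act r v0) -> forall x, side adj a b x -> side adj a b (act r x).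
Proof.
move=> ax ab nS Sr x Sx.
have sab : sep adj a b v0 (act r v0).
  by move=> /(side_conn_eq Vt) H; apply: nS; apply/H.
have Srr : side adj a b (act r (act r v0)).
  have c : conn (cut adj a b) (act r v0) (act r (act r v0)).
    by apply: contrapT; apply: ax sab.
  exact: side_conn Sr.
have c0 : conn (cut adj (act r a) (act r b)) v0 (act r v0).
  apply: contrapT => s; apply: (ax _ _ (act_adj r ab) s).
  exact: sep_act.
have nrS : ~ side adj (act r a) (act r b) (act r v0).
  by move=> /(side_act actP act_adj r^-1); rewrite !actK.
have rSr : side adj (act r a) (act r b) (act r (act r v0)) by apply: side_act.
have rSx : side adj (act r a) (act r b) (act r x) by apply: side_act.
have [//|c0a] := conn_cut_or a b (@cut_adj _ _) c0.
have nrSa : ~ side adj (act r a) (act r b) a.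
  by move=> /(side_conn (conn_cutC Vt (conn_trans (conn_cutC Vt c0) c0a))).
have [c|ca] := conn_cut_or a b (@cut_adj _ _) (conn_side Vt rSr rSx); first exact: side_conn Srr.
by case: nrSa; apply: side_conn rSr.
Qed.

Lemma axis_hyperbolic r v0 a b E v j : on_axis r v0 -> adj a b ->
  sep adj a b v0 (act r v0) ->
  (forall x y, E x y -> E (act r x) (act r y)) ->
  (forall x y, E x y -> E (act r^-1 x) (act r^-1 y)) ->
  (forall x y, E x y -> cut adj a b x y) ->
  conn E v (act (r ^+ j) v) -> j = 0%N.
Proof.
move=> ax; wlog nS : a b / ~ side adj a b v0.
  move=> H ab sab Er Eri Ecut; have [S0|S0] := pselect (side adj a b v0).
    apply: (H b a) => //; last 3 first.
    - exact: Vt.1.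
    - exact: sepC.
    - by move=> x y /Ecut c; apply: cutC.
    by move=> S0'; apply: (Vt.2 _ _ ab);
      apply: conn_trans (conn_cut_flip S0') (conn_cutC Vt S0).
  exact: (H a b).
move=> ab sab Er Eri Ecut.
have Sr : side adj a b (act r v0).
  apply: contrapT => nSr; apply: sab.
  exact: (sideC_conn Vt (Vconn _ _) (Vconn _ _) nS nSr).
apply: (hyperbolic actP Vt Vconn act_adj ab (axis_side ax ab nS Sr) Sr) => //.
by rewrite actK.
Qed.

Lemma axis_dead r v0 a b H v j : is_subgroup H -> H r -> on_axis r v0 -> adj a b ->
  sep adj a b v0 (act r v0) -> conn (dead a b H) v (act (r ^+ j) v) -> j = 0%N.
Proof.
move=> Hsg Hr ax ab sab; apply: (axis_hyperbolic ax ab sab).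
- by move=> x y; apply: dead_act.
- by move=> x y; apply: dead_act => //; apply: sgV.
- by move=> x y /(dead_cut (sg1 Hsg)); rewrite !actP.1.
Qed.

Lemma axis_inf r v0 a b : on_axis r v0 -> adj a b ->
  sep adj a b v0 (act r v0) -> forall n, r ^+ n = 1 -> n = 0%N.
Proof.
move=> ax ab sab n e.
apply: (axis_hyperbolic (v := v0) (E := fun _ _ => False) ax ab sab) => //.
by rewrite e actP.1; apply: conn0.
Qed.

(** * The tree of pieces over the cosets of a subgroup *)

Section StarTree.
Variables (a b : V) (H M : set F).
Hypothesis ab : adj a b.
Hypothesis Hsg : is_subgroup H.
Hypothesis Msg : is_subgroup M.

Definition coset (h : F) : set F := [set x | M (h^-1 * x)].

(** An orbit edge [f e] is present only over the leaf of its own coset, any other edge over the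
    whole star. So level [None] keeps the edges outside the orbit, and the leaf [h M] adds the edges
    [h M e] to them. *)
Definition star_J (u v : V) (l : option (set F)) :=
  forall f, H f -> edge_at a b f u v -> l = Some (coset f).

Definition coset_act (f : F) (l : option (set F)) :=
  omap (fun S : set F => [set x | S (f^-1 * x)]) l.

Lemma coset_eq f g : coset f = coset g <-> M (f^-1 * g).
Proof.
split=> [e|fg].
  have : coset g g by rewrite /coset /= mulVg; apply: sg1.
  by rewrite -e.
apply/seteqP; split=> x /= mx.
  have := sgM Msg (sgV Msg fg) mx.
  by rewrite invgM invgK !mulgA mulgK.
by have := sgM Msg fg mx; rewrite !mulgA mulgK.
Qed.

Lemma coset_actE f g : coset_act f (Some (coset g)) = Some (coset (f * g)).
Proof. by congr Some; apply/seteqP; split=> x; rewrite /coset /= invgM mulgA. Qed.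

Lemma coset_actP : is_left_action coset_act.
Proof.
split=> [[S|]|f g [S|]] //=; congr Some; apply/seteqP; split=> x /=.
- by rewrite invg1 mul1g.
- by rewrite invg1 mul1g.
- by rewrite invgM mulgA.
- by rewrite invgM mulgA.
Qed.

Lemma coset_act_star f k l : star k l -> star (coset_act f k) (coset_act f l).
Proof. by case=> -[-> nN]; [left|right]; split=> //; case: k l nN => [?|] [?|]. Qed.

Lemma star_JC u v l : star_J u v l -> star_J v u l.
Proof. by move=> Juv f Hf /edge_atC; apply: Juv. Qed.

Lemma star_J_conn u v k l : adj u v -> star_J u v k -> star_J u v l ->
  conn (fun s t => [/\ star s t, star_J u v s & star_J u v t]) k l.
Proof.
move=> uv Jk Jl; have [[f [Hf e]]|no] := pselect (exists f, H f /\ edge_at a b f u v).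
  by rewrite (Jk f) // (Jl f) //; apply: conn0.
apply: sub_conn (star_conn k l) => s t st.
by split=> // f Hf e; case: no; exists f.
Qed.

Lemma star_J_ne u v : adj u v -> exists l, star_J u v l.
Proof.
move=> uv; have [[f [Hf e]]|no] := pselect (exists f, H f /\ edge_at a b f u v).
  by exists (Some (coset f)) => g Hg e'; rewrite (edge_at_uniq ab e e').
by exists None => f Hf e; case: no; exists f.
Qed.

Lemma star_J_act f u v l : H f -> star_J u v l ->
  star_J (act f u) (act f v) (coset_act f l).
Proof.
move=> Hf Jl g Hg /edge_at_act /Jl ->; last by apply: (sgM Hsg) => //; apply: (sgV Hsg).
by rewrite coset_actE mulgA mulgV mul1g.
Qed.

Definition star_adj := tadj adj (@star (set F)) star_J.
Definition star_comp := lcomp adj star_J.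
Definition star_act := tact act coset_act.

Lemma star_adj_bridged : bridged star_adj.
Proof.
exact: (tadj_bridged Vt Vconn (@star_bridged _) star_JC star_J_conn).
Qed.

Lemma star_adj_conn k l u v : conn star_adj (k, star_comp k u) (l, star_comp l v).
Proof. exact: (tadj_conn Vt Vconn (@star_conn _) star_JC star_J_ne). Qed.

Lemma star_actP : is_left_action star_act.
Proof. exact: tactP actP coset_actP. Qed.

Lemma star_compE f l v : H f ->
  act f @` star_comp l v = star_comp (coset_act f l) (act f v).
Proof. exact: (lcomp_act actP coset_actP Hsg act_adj star_J_act). Qed.

Lemma star_act_adj f x y : H f -> star_adj x y -> star_adj (star_act f x) (star_act f y).
Proof.
apply: (tact_adj actP coset_actP Hsg act_adj _ star_J_act).
by move=> g k l _; apply: coset_act_star.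
Qed.

Lemma star_comp_eq l u v : star_comp l u = star_comp l v <-> conn (lvl adj star_J l) u v.
Proof. exact: (lcomp_eq Vt star_JC). Qed.

Lemma lvl_None u v : lvl adj star_J None u v <-> dead a b H u v.
Proof.
split=> -[uv J]; split=> // f Hf; first by move=> /(J f Hf).
by move=> /(J f Hf).
Qed.

Lemma lvl_coset u v : lvl adj star_J (Some (coset 1)) u v <->
  adj u v /\ forall f, H f -> edge_at a b f u v -> M f.
Proof.
split=> -[uv J]; split=> // f Hf e.
  by have [/coset_eq] := J f Hf e; rewrite invg1 mul1g.
by congr Some; apply/coset_eq; rewrite invg1 mul1g; apply: J e.
Qed.

Lemma star_act_dead f v : H f -> star_act f (None, star_comp None v) =
  (None, star_comp None v) <-> conn (dead a b H) v (act f v).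
Proof.
move=> Hf; rewrite /star_act /tact /= star_compE //.
split=> [[/star_comp_eq c]|c].
  by apply: (conn_sym (dead_sym (H := H))); apply: sub_conn c => s t /lvl_None.
congr pair; apply/star_comp_eq; apply: (conn_sym (@lvl_sym _ _ _ Vt _ star_JC None)).
by apply: sub_conn c => s t /lvl_None.
Qed.

Lemma star_act_coset f g v : H f ->
  star_act f (Some (coset g), star_comp (Some (coset g)) v) =
  (Some (coset (f * g)), star_comp (Some (coset (f * g))) (act f v)).
Proof. by move=> Hf; rewrite /star_act /tact star_compE // !coset_actE. Qed.

End StarTree.

(* The rotating family lives on the tree whose vertices are the components left
   after deleting [H e] and, for each coset [h F0], the component of [h v0] left
   after deleting only the edges of [H e] outside [h F0 e]. *)
Lemma relator_extend (a b v0 : V) (H F0 : set F) (r : F) : adj a b ->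
  is_subgroup H -> is_subgroup F0 -> F0 `<=` H -> F0 r ->
  (forall f, F0 f -> conn (fun u v => adj u v /\
     forall g, H g -> edge_at a b g u v -> F0 g) v0 (act f v0)) ->
  Wh (rel_conj F0 r) ->
  (forall n v, generated (rel_conj F0 r) n -> conn (dead a b F0) v (act n v) -> n = 1) ->
  Wh (rel_conj H r) /\
  forall n v, generated (rel_conj H r) n -> conn (dead a b H) v (act n v) -> n = 1.
Proof.
move=> ab Hsg Fsg FH Fr Fv0 FWh Ffree.
pose sact := star_act;
pose k1 : option (set F) * set V := (Some (coset F0 1), star_comp a b H F0 (Some (coset F0 1)) v0).
pose Y w := [set y | exists2 h, H h & w = sact h k1 /\ y = h * r * h^-1].
have Hr : H r by apply: FH.
have sactP : is_left_action sact by apply: star_actP.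
have F0k1 f : F0 f -> sact f k1 = k1.
  move=> Ff; rewrite /sact /k1; have Hf := FH _ Ff; rewrite star_act_coset // mulg1.
  have -> : coset F0 f = coset F0 1.
    by apply/coset_eq => //; rewrite mulg1; apply: (sgV Fsg).
  congr pair; apply/star_comp_eq; apply: (conn_sym (@lvl_sym _ _ _ Vt _ (@star_JC a b H F0) _)).
  by apply: sub_conn (Fv0 _ Ff) => u v /lvl_coset; apply.
have k1F0 h : sact h k1 = k1 -> F0 h.
  move=> /(congr1 fst) e; have {e} : coset_act h k1.1 = k1.1 := e.
  by rewrite /k1 coset_actE mulg1 => -[/esym/(coset_eq Fsg)]; rewrite invg1 mul1g.
(* The stabilizer of [k1] in [H] is [F0], so the relators at [sact h k1] are the [h]-conjugates of
   those of [F0]. *)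
have YE h : H h -> Y (sact h k1) = conj_set h (rel_conj F0 r).
  move=> Hh; apply/seteqP; split=> y; rewrite /conj_set /=.
    case=> h' Hh' [e ->]; exists (h^-1 * h'); last first.
      by rewrite invgM invgK !mulgA.
    by apply: k1F0; rewrite sactP.2 -e actK.
  case=> f Ff e; exists (h * f); first by apply: (sgM Hsg) => //; apply: FH.
  split; first by rewrite sactP.2 (F0k1 f).
  have -> : h * f * r / (h * f) = h * (f * r * f^-1) * h^-1 by rewrite invgM !mulgA.
  by rewrite -e !mulgA mulgV mul1g mulgK.
have Y0 w : (exists2 h, H h & w = sact h k1) \/ Y w = set0.
  have [[h Hh e]|no] := pselect (exists2 h, H h & w = sact h k1).
    by left; exists h.
  by right; apply/seteqP; split=> // y [h Hh [e _]]; apply: no; exists h.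
have Tb : bridged (star_adj a b H F0) by apply: star_adj_bridged.
have YWh w : Wh (Y w).
  have [[h Hh ->]|->] := Y0 w; last exact: Wh_set0.
  by rewrite YE //; apply: Wh_conj.
have Y_sub w : Y w `<=` H.
  by move=> _ [h Hh [_ ->]]; apply: (sgM Hsg); [apply: (sgM Hsg)|apply: (sgV Hsg)].
have Y_fix w y : Y w y -> sact y w = w.
  by case=> h Hh [-> ->]; rewrite -sactP.2 mulgVK sactP.2 F0k1.
have Y_act g w : H g -> Y (sact g w) = conj_set g (Y w).
  move=> Hg; apply/seteqP; split=> y; rewrite /conj_set /= => -[h Hh [e1 e2]].
    exists (g^-1 * h); first by apply: (sgM Hsg) => //; apply: (sgV Hsg).
    by rewrite sactP.2 -e1 actK // e2 invgM invgK !mulgA.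
  exists (g * h); first exact: (sgM Hsg).
  rewrite sactP.2 -e1; split=> //.
  have -> : g * h * r / (g * h) = g * (h * r * h^-1) * g^-1 by rewrite invgM !mulgA.
  by rewrite -e2 !mulgA mulgV mul1g mulgK.
have Y_adj x u n : star_adj a b H F0 x u -> generated (Y x) n -> sact n u = u -> n = 1.
  have [[h Hh ->]|->] := Y0 x; last by move=> _ /generated0.
  rewrite YE // generated_conj_set /conj_set /= => -[st [v [_ eu]]] Nn.
  have -> : u = (None, star_comp a b H F0 None v).
    case: u st eu => [[l|] Q] /=; last by move=> _ ->.
    by case=> -[].
  have Nn' : rel_conj F0 r `<=` H.
    by move=> _ [f /FH Hf ->]; apply: (sgM Hsg); [apply: (sgM Hsg)|apply: (sgV Hsg)].
  have Hn' : H (h^-1 * n * h) by apply: generated_min Nn.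
  have Hn : H n.
    by have := sgM Hsg (sgM Hsg Hh Hn') (sgV Hsg Hh); rewrite !mulgA mulgV mul1g mulgK.
  (* [n] preserves a component avoiding all of [H e]. Translated by [h^-1], this lies in a component
     avoiding [F0 e], where [Ffree] applies. *)
  move=> e; have c := (@star_act_dead a b H F0 Hsg n v Hn).1 e.
  have n1 : h^-1 * n * h = 1.
    apply: (Ffree _ (act h^-1 v) Nn); rewrite !actP.2 actVK //.
    apply: (conn_map (h := act h^-1)) c => s t dst; apply: conn1.
    have [st' nst] : dead a b H (act h^-1 s) (act h^-1 t).
      by apply: dead_act => //; apply: (sgV Hsg).
    by split=> // f /FH; apply: nst.
  have := congr1 (fun x => h * x * h^-1) n1.
  by rewrite /= mulg1 mulgV !mulgA mulgV mul1g mulgK.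
have Y_reach w y : Y w y -> conn (star_adj a b H F0) k1 w.
  case=> h Hh [-> _]; rewrite /sact /k1 star_act_coset //.
  exact: star_adj_conn.
have YU : [set y | exists w, Y w y] = rel_conj H r.
  apply/seteqP; split=> y [h]; first by case=> h' Hh' [_ ->]; exists h'.
  by move=> Hh ->; exists (sact h k1), h.
have := rotation sactP Tb Hsg
  (fun g x y Hg => @star_act_adj a b H F0 Hsg g x y Hg) Y_sub Y_fix Y_act Y_adj Y_reach YWh.
rewrite /= YU => -[HWh Hstab]; split=> // n v Nn c.
have Hn : H n by apply: (@generated_rel_conj _ H H r).
have e := (@star_act_dead a b H F0 Hsg n v Hn).2 c.
have := Hstab _ _ (@star_adj_conn a b H F0 ab _ _ _ _) Nn e.
(* No relators sit at level [None], so [n] is generated by the empty set. *)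
have -> : Y (None, star_comp a b H F0 None v) = set0; last exact: generated0.
apply/seteqP; split=> // y [h Hh [e' _]].
by move: e'; rewrite /sact /k1 star_act_coset.
Qed.

(* The levels [2 i] and [2 i + 1] stand for the forests of edges of heights in
   [i + lo, i + hi] and [i + 1 + lo, i + hi]. *)
Section Heights.
Variables (a b v0 : V) (H : set F) (r : F) (phi : F -> Z) (lo hi : Z).
Hypothesis ab : adj a b.
Hypothesis Hsg : is_subgroup H.
Hypothesis Hr : H r.
Hypothesis phiM : forall f g, H f -> H g -> phi (f * g) = (phi f + phi g)%Z.
Hypothesis phi_r : phi r = 0%Z.
Hypothesis lo_hi : (lo < hi)%Z.
Hypothesis phi_sep : forall f, H f -> esep a b v0 (act r v0) f ->
  (lo <= phi f <= hi)%Z.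

Let ker : set F := [set f | H f /\ phi f = 0%Z].

Let phi1 : phi 1 = 0%Z.
Proof. have := phiM (sg1 Hsg) (sg1 Hsg); rewrite mul1g; lia. Qed.

Let phiV f : H f -> phi f^-1 = (- phi f)%Z.
Proof. by move=> Hf; have := phiM (sgV Hsg Hf) Hf; rewrite mulVg phi1; lia. Qed.

Let ker_sg : is_subgroup ker.
Proof.
apply: is_subgroupI => /= [|x [Hx ex]|x y [Hx ex] [Hy ey]].
- by split=> //; apply: (sg1 Hsg).
- by split; [apply: (sgV Hsg)|rewrite phiV // ex].
- by split; [apply: (sgM Hsg)|rewrite phiM // ex ey].
Qed.

Let kerH : ker `<=` H. Proof. by move=> x []. Qed.

Let J (u v : V) (k : Z) := forall f, H f -> edge_at a b f u v ->
  (2 * (phi f - hi) <= k <= 2 * (phi f - lo))%Z.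

Let JC u v k : J u v k -> J v u k.
Proof. by move=> Juv f Hf /edge_atC; apply: Juv. Qed.

Let J_conn u v k l : adj u v -> J u v k -> J u v l ->
  conn (fun s t => [/\ line s t, J u v s & J u v t]) k l.
Proof.
move=> uv Jk Jl; apply: sub_conn (line_interval k l) => s t [st sI tI].
split=> // f Hf e; have := Jk f Hf e; have := Jl f Hf e; lia.
Qed.

Let J_ne u v : adj u v -> exists l, J u v l.
Proof.
move=> uv; have [[f [Hf e]]|no] := pselect (exists f, H f /\ edge_at a b f u v).
  by exists (2 * (phi f - hi))%Z => g Hg e'; rewrite (edge_at_uniq ab e e'); lia.
by exists 0%Z => f Hf e; case: no; exists f.
Qed.

Let lact (f : F) (l : Z) := l.

Let lactP : is_left_action lact. Proof. by []. Qed.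

Let J_act f u v l : ker f -> J u v l -> J (act f u) (act f v) (lact f l).
Proof.
move=> [Hf ef] Jl g Hg /edge_at_act /Jl.
by rewrite phiM ?phiV ?ef //=; [apply; apply: (sgM Hsg) => //|]; apply: (sgV Hsg).
Qed.

Let hadj := tadj adj line J.
Let hcomp := lcomp adj J.
Let hact := tact act lact.

Let hactP : is_left_action hact. Proof. exact: tactP actP lactP. Qed.

Let hcompE f l v : ker f -> act f @` hcomp l v = hcomp l (act f v).
Proof. exact: (lcomp_act actP lactP ker_sg act_adj J_act). Qed.

Let hact_adj f x y : ker f -> hadj x y -> hadj (hact f x) (hact f y).
Proof. exact: (tact_adj actP lactP ker_sg act_adj (fun _ _ _ _ => id) J_act). Qed.

Let hcomp_eq l u v : hcomp l u = hcomp l v <-> conn (lvl adj J l) u v.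
Proof. exact: (lcomp_eq Vt JC). Qed.

(** By [phi_sep] the orbit edges between the two vertices have heights from [phi f + lo] to
    [phi f + hi], exactly the range present at this level. *)
Let lvl_r f : H f -> conn (lvl adj J (2 * phi f)%Z) (act f v0) (act f (act r v0)).
Proof.
move=> Hf; apply: contrapT => nc.
have [|p [q [pq nJ _ spq]]] := sep_exists Vt _ (Vconn _ _) nc; first by move=> u v [].
apply: nJ; split=> // g Hg e.
have Hg' : H (f^-1 * g) by apply: (sgM Hsg) => //; apply: (sgV Hsg).
have := phi_sep Hg' (esep_act (esep_edge_at e spq)).
by rewrite phiM ?phiV //; [lia|apply: (sgV Hsg)].
Qed.

(** The vertex of the height tree that carries the axis of [f * r * f^-1]. *)
Let kap f := ((2 * phi f)%Z, hcomp (2 * phi f)%Z (act f v0)).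

Let kap_act k f : ker k -> H f -> kap (k * f) = hact k (kap f).
Proof.
by move=> [Hk ek] Hf; rewrite /kap phiM // ek Z.add_0_l /hact /tact /= hcompE // actP.2.
Qed.

Let kap_r f : H f -> kap (f * r) = kap f.
Proof.
move=> Hf; rewrite /kap phiM // phi_r Z.add_0_r actP.2; congr pair.
apply/hcomp_eq; apply: conn_sym (lvl_r Hf).
exact: (@lvl_sym _ _ _ Vt _ JC).
Qed.

Let conj_ker f : H f -> ker (f * r * f^-1).
Proof.
move=> Hf; have Hfi := sgV Hsg Hf; have Hfr := sgM Hsg Hf Hr.
by split; [apply: (sgM Hsg)|rewrite !phiM // phi_r phiV //; lia].
Qed.

Let Y w := [set y | exists2 f, H f & w = kap f /\ y = f * r * f^-1].

Let stab f : set F := [set k | ker k /\ hact k (kap f) = kap f].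

Let stab_sg f : is_subgroup (stab f).
Proof.
apply: is_subgroupI => [|x [kx ex]|x y [kx ex] [ky ey]].
- by split; [apply: (sg1 ker_sg)|apply: hactP.1].
- by split; [apply: (sgV ker_sg)|rewrite -{1}ex actK].
- by split; [apply: (sgM ker_sg)|rewrite hactP.2 ey ex].
Qed.

Let stab_r f : H f -> stab f (f * r * f^-1).
Proof.
move=> Hf; split; first exact: conj_ker.
rewrite -kap_act //; last exact: conj_ker.
by rewrite mulgVK kap_r.
Qed.

(** If [kap g = kap f], then [f] and [g] have equal heights, so [g * f^-1] lies in the kernel and
    stabilizes this vertex. *)
Let YE f : H f -> Y (kap f) = rel_conj (stab f) (f * r * f^-1).
Proof.
move=> Hf; have Hfi := sgV Hsg Hf.
apply/seteqP; split=> [y [g Hg [e ->]]|y [k [kk ek] ->]].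
  have ephi : phi f = phi g by have e1 : (2 * phi f = 2 * phi g)%Z := congr1 fst e; lia.
  have kgf : ker (g * f^-1).
    by split; [apply: (sgM Hsg)|rewrite phiM // phiV // ephi; lia].
  exists (g * f^-1); first by split=> //; rewrite -kap_act // mulgVK.
  by rewrite invgM invgK !mulgA !mulgVK.
exists (k * f); first by apply: (sgM Hsg) => //; apply: kerH.
by rewrite kap_act // ek; split=> //; rewrite invgM !mulgA.
Qed.

Variables (llo lhi : F).
Hypothesis Hllo : H llo.
Hypothesis Hlhi : H lhi.
Hypothesis phi_llo : phi llo = lo.
Hypothesis phi_lhi : phi lhi = hi.
Hypothesis IH : forall f M l, H f -> is_subgroup M -> M `<=` H ->
  (forall m, M m -> phi m = 0%Z) -> M (f * r * f^-1) -> l = llo \/ l = lhi ->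
  Wh (rel_conj M (f * r * f^-1)) /\
  forall n v, generated (rel_conj M (f * r * f^-1)) n ->
    conn (dead (act (f * l) a) (act (f * l) b) M) v (act n v) -> n = 1.

Let IHs f l : H f -> l = llo \/ l = lhi ->
  Wh (Y (kap f)) /\ forall n v, generated (Y (kap f)) n ->
    conn (dead (act (f * l) a) (act (f * l) b) (stab f)) v (act n v) -> n = 1.
Proof.
move=> Hf El; rewrite YE //; apply: IH => //.
- by move=> x [/kerH].
- by move=> x [[]].
- exact: stab_r.
Qed.

Let Y0 w : (exists2 f, H f & w = kap f) \/ Y w = set0.
Proof.
have [[f Hf e]|no] := pselect (exists2 f, H f & w = kap f); first by left; exists f.
by right; apply/seteqP; split=> // y [f Hf [e _]]; apply: no; exists f.
Qed.

Let lvl_dead f l k u v : H f -> H l -> (k < 2 * (phi f + phi l - hi) \/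
  2 * (phi f + phi l - lo) < k)%Z -> lvl adj J k u v ->
  dead (act (f * l) a) (act (f * l) b) (stab f) u v.
Proof.
move=> Hf Hl kb [uv Juv]; split=> // m [[Hm em] _] e.
have Hfl := sgM Hsg Hf Hl; have := Juv (m * (f * l)) (sgM Hsg Hm Hfl).
rewrite /edge_at !(actP.2 m) => /(_ e); rewrite phiM // phiM // em; lia.
Qed.

(** The level above [2 * phi f] omits the height [phi f + lo], the one below omits [phi f + hi]. A
    component there avoids the orbit of the edge at [f * llo] or at [f * lhi], and the Freiheitssatz
    in [IH] applies. *)
Let Y_adj x u n : hadj x u -> generated (Y x) n -> hact n u = u -> n = 1.
Proof.
have [[f Hf ->]|->] := Y0 x; last by move=> _ /generated0.
case: u => k Q [kl [v [_ eQ]]] Nn e.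
have {}kl : line (2 * phi f)%Z k := kl; have {}eQ : Q = hcomp k v := eQ.
have kn : ker n.
  have H1 : generated (Y (kap f)) `<=` stab f.
    by rewrite YE //; apply: generated_rel_conj => //; apply: stab_r.
  by have [] := H1 _ Nn.
have c : conn (lvl adj J k) v (act n v).
  have := congr1 snd e; rewrite /= eQ hcompE // => /hcomp_eq; apply: conn_sym.
  exact: (@lvl_sym _ _ _ Vt _ JC).
case: kl => kl.
  apply: (IHs Hf (or_introl erefl)).2 Nn _.
  by apply: sub_conn c => s t; apply: lvl_dead => //; rewrite ?phi_llo ?phi_lhi; lia.
apply: (IHs Hf (or_intror erefl)).2 Nn _.
by apply: sub_conn c => s t; apply: lvl_dead => //; rewrite ?phi_llo ?phi_lhi; lia.
Qed.

Lemma relator_kernel :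
  Wh (rel_conj H r) /\
  forall n v, generated (rel_conj H r) n -> conn (dead a b H) v (act n v) -> n = 1.
Proof.
have Tb : bridged hadj by apply: (tadj_bridged Vt Vconn line_bridged JC J_conn).
have Tc k l u v : conn hadj (k, hcomp k u) (l, hcomp l v).
  exact: (tadj_conn Vt Vconn line_conn JC J_ne).
have YWh w : Wh (Y w).
  have [[f Hf ->]|->] := Y0 w; last exact: Wh_set0.
  by have [] := IHs Hf (or_introl erefl).
have Y_sub w : Y w `<=` ker by move=> _ [f Hf [_ ->]]; apply: conj_ker.
have Y_fix w y : Y w y -> hact y w = w.
  case=> f Hf [-> ->]; rewrite -kap_act //; last exact: conj_ker.
  by rewrite mulgVK kap_r.
have Y_act g w : ker g -> Y (hact g w) = conj_set g (Y w).
  move=> kg; have Hg := kerH kg; have kgi := sgV ker_sg kg.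
  apply/seteqP; split=> y; rewrite /conj_set /= => -[f Hf [e1 e2]].
    exists (g^-1 * f); first by apply: (sgM Hsg) => //; apply: (sgV Hsg).
    by rewrite kap_act // -e1 actK // e2 invgM invgK !mulgA.
  exists (g * f); first exact: (sgM Hsg).
  rewrite kap_act // -e1; split=> //.
  have -> : g * f * r / (g * f) = g * (f * r * f^-1) * g^-1 by rewrite invgM !mulgA.
  by rewrite -e2 !mulgA mulgV mul1g mulgK.
have Y_reach w y : Y w y -> conn hadj (kap 1) w by case=> f Hf [-> _]; apply: Tc.
have YU : [set y | exists w, Y w y] = rel_conj H r.
  apply/seteqP; split=> y; first by case=> w [f Hf [_ ->]]; exists f.
  by case=> f Hf ->; exists (kap f), f.
have := rotation hactP Tb ker_sg (@hact_adj) Y_sub Y_fix Y_act Y_adj Y_reach YWh.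
rewrite /= YU => -[HWh Hstab]; split=> // n v Nn c.
have kn : ker n.
  by apply: generated_min Nn => // _ [f Hf ->]; apply: conj_ker.
(* Level 1 is odd, so no relators sit there. Edges outside the orbit occur at every level, so [n]
   fixes the component of [v] at this one. *)
have e : hact n (1%Z, hcomp 1 v) = (1%Z, hcomp 1 v).
  rewrite /hact /tact /= hcompE //; congr pair; apply/hcomp_eq; apply: conn_sym.
    exact: (@lvl_sym _ _ _ Vt _ JC).
  by apply: sub_conn c => s t [st nH]; split=> // f Hf /nH; case.
have := Hstab _ _ (Tc _ _ _ _) Nn e.
have -> : Y (1%Z, hcomp 1 v) = set0; last exact: generated0.
apply/seteqP; split=> // y [f Hf [e' _]].
have e1 : (1 = 2 * phi f)%Z := congr1 fst e'; lia.
Qed.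

End Heights.

Lemma cyclic_conn (E : V -> V -> Prop) g n v :
  (forall x y, E x y -> E y x) ->
  (forall x y, E x y -> E (act g x) (act g y)) ->
  (forall k v, conn E v (act (g ^+ k) v) -> k = 0%N) ->
  generated [set g] n -> conn E v (act n v) -> n = 1.
Proof.
move=> Esym Eg Einf /cyclicP[i [j ->]].
have EX k x y : conn E x y -> conn E (act (g ^+ k) x) (act (g ^+ k) y).
  elim: k x y => [|k IH] x y; first by rewrite !actP.1.
  move=> /IH; rewrite !expgS !actP.2.
  by apply: (conn_map (h := act g)) => s t st; apply/conn1/Eg.
move=> /(EX j); rewrite -actP.2.
have -> : g ^+ j * (g ^+ i / g ^+ j) = g ^+ i.
  have c : commute (g ^+ i) (g ^+ j)^-1 by apply/commuteV/commuteX2.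
  by rewrite c mulgA mulgV mul1g.
have [ij|ji] := leqP i j.
  have {1}-> : g ^+ j = g ^+ (j - i) * g ^+ i by rewrite -expgnDr subnK.
  rewrite actP.2 => /(conn_sym Esym)/Einf/eqP; rewrite subn_eq0 => ji.
  have -> : i = j by apply/eqP; rewrite eqn_leq ij.
  exact: mulgV.
have {1}-> : g ^+ i = g ^+ (i - j) * g ^+ j by rewrite -expgnDr subnK // ltnW.
by rewrite actP.2 => /Einf/eqP; rewrite subn_eq0 leqNgt ji.
Qed.

(** The edge [a b] and its translate by [t] bound a common component, with [b] facing [act t a]. So
    [t] carries the half-tree beyond [b] strictly into itself, and [hyperbolic] applies. *)
Lemma translate_dead a b H t k v : adj a b -> is_subgroup H -> H t ->
  conn (dead a b H) b (act t a) -> conn (dead a b H) v (act (t ^+ k) v) -> k = 0%N.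
Proof.
move=> ab Hsg Ht bta.
have H1 := sg1 Hsg; have Hti := sgV Hsg Ht.
have dc1 u w : dead a b H u w -> cut adj a b u w.
  by move=> /(dead_cut H1); rewrite !actP.1.
have dct u w : dead a b H u w -> cut adj (act t a) (act t b) u w.
  exact: dead_cut.
have Sta : side adj a b (act t a) by apply: sub_conn bta.
have Stb : side adj a b (act t b).
  apply: contrapT => nS; have [eb ea] := side_step (act_adj t ab) Sta nS.
  exact: (act_noinv ab eb ea).
have ntb : ~ side adj (act t a) (act t b) b.
  move=> /(side_conn (sub_conn dct bta)).
  by apply: sideN => //; apply: act_adj.
have nta : ~ side adj (act t a) (act t b) a.
  move=> Sa; have [ea eb] := side_step ab Sa ntb.
  exact: (act_noinv ab (esym eb) (esym ea)).
apply: (hyperbolic actP Vt Vconn act_adj ab _ Sta (g := t)).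
- move=> x Sx; have Stx := side_act actP act_adj t Sx.
  have [c|c] := conn_cut_or a b (@cut_adj _ _) Stx; last by case: nta.
  exact: side_conn Stb.
- by rewrite actK //; apply: sideN.
- by move=> x y; apply: dead_act.
- by move=> x y; apply: dead_act.
- exact: dc1.
Qed.

(** * Free splitting of a finitely generated subgroup along an edge orbit *)

Section Splitting.
Hypothesis F_li : locally_indicable F.
Variables (a b : V) (H : set F) (s : seq F) (r : F).
Hypothesis ab : adj a b.
Hypothesis HE : H = generated [set` s].
Hypothesis Hr : H r.
Hypothesis r_dead : forall v, ~ conn (dead a b H) v (act r v).

Let Hsg : is_subgroup H.
Proof. by rewrite HE; apply: is_subgroup_generated. Qed.

Let deadC := @dead_sym a b H.

Let dead_mul f u v : H f -> conn (dead a b H) u v ->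
  conn (dead a b H) (act f u) (act f v).
Proof.
by move=> Hf; apply: (conn_map (h := act f)) => x y xy; apply: conn1; apply: dead_act.
Qed.

Let ab_dead : ~ conn (dead a b H) a b.
Proof.
move=> c; apply: (Vt.2 _ _ ab); apply: sub_conn c => u v.
by move=> /(dead_cut (sg1 Hsg)); rewrite !actP.1.
Qed.

Section Factors.
Variable M : set F.
Hypothesis Msg : is_subgroup M.
Hypothesis MH : M `<=` H.
Hypothesis M_conn : forall m, M m ->
  conn (fun u v => adj u v /\ forall f, H f -> edge_at a b f u v -> M f) a (act m a).

Definition dead_piece v : option (set F) * set V := (None, star_comp a b H M None v).
Definition center : option (set F) * set V :=
  (Some (coset M 1), star_comp a b H M (Some (coset M 1)) a).
Definition piece_stab w := [set f | [/\ H f, star_act f w = w & w.1 <> None -> M f]].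
Local Notation adjw := (star_adj a b H M).

Lemma piece_stab_sg w : is_subgroup (piece_stab w).
Proof.
have aP := star_actP; apply: is_subgroupI => [|x [Hx ex Mx]|x y [Hx ex Mx] [Hy ey My]].
- by split=> [||_]; [apply: (sg1 Hsg)|apply: aP.1|apply: (sg1 Msg)].
- split=> [||/Mx]; [exact: (sgV Hsg)| |exact: (sgV Msg)].
  by rewrite -{1}ex actK.
- split=> [||h]; [exact: (sgM Hsg)| |apply: (sgM Msg); [exact: Mx|exact: My]].
  by rewrite aP.2 ey ex.
Qed.

Lemma center_stab m : M m -> piece_stab center m.
Proof.
move=> Mm; have Hm := MH Mm; split=> //.
rewrite star_act_coset // mulg1.
have -> : coset M m = coset M 1 by apply/coset_eq; rewrite // mulg1; apply: (sgV Msg).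
congr pair; apply/star_comp_eq; apply: (conn_sym (@lvl_sym _ _ _ Vt _ (@star_JC a b H M) _)).
by apply: sub_conn (M_conn Mm) => u v /lvl_coset; apply.
Qed.

Lemma piece_stab_dead v n : H n -> conn (dead a b H) v (act n v) -> piece_stab (dead_piece v) n.
Proof. by move=> Hn c; split=> //; apply/star_act_dead. Qed.

Variable D : set (option (set F) * set V).
Hypothesis D_y0 : D center.
Hypothesis D_adj : forall w, D w -> w = center \/ w.1 = None /\ adjw w center.
Hypothesis D_key : forall u v n, D u -> D v -> u.1 = None -> v.1 = None -> M n ->
  star_act n u = v -> n = 1.

(** [D] is a star about [center], and [D_key] is the freeness that ping-pong needs; two nontrivial
    factors then feed [two_factor_hom]. *)
Lemma factors_hom w m n : D w -> w <> center -> piece_stab w m -> m <> 1 ->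
  (piece_stab center n \/ exists2 w', D w' /\ w' <> w & piece_stab w' n) -> n <> 1 ->
  H `<=` word_group piece_stab D ->
  exists phi : F -> Z,
  [/\ zhom_on H phi, phi r = 0%Z & exists2 f, H f & phi f <> 0%Z].
Proof.
move=> Dw wy0 nm m1 Hn n1 Hw.
have Tb : bridged adjw by apply: star_adj_bridged.
have D_conn x y : D x -> D y ->
    conn (fun s t => [/\ adjw s t, D s & D t]) x y.
  have base z : D z -> conn (fun s t => [/\ adjw s t, D s & D t]) z center.
    move=> Dz; have [->|[_ zy]] := D_adj Dz; first exact: conn0.
    exact: conn1.
  move=> /base xy0 /base yy0; apply: conn_trans xy0 (conn_sym _ yy0).
  by move=> u v [/Tb.1].
have D_free x u v k : D x -> D u -> D v -> adjw x u -> adjw x v ->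
    piece_stab x k -> star_act k u = v -> k = 1.
  move=> Dx Du Dv xu xv [Hk ek Mk] e.
  have [ex|[x1 _]] := D_adj Dx.
    have [eu|[u1 _]] := D_adj Du.
      by case: (adj_neq Tb xu); rewrite ex eu.
    have [ev|[v1 _]] := D_adj Dv.
      by case: (adj_neq Tb xv); rewrite ex ev.
    by apply: (D_key Du Dv) => //; apply: Mk; rewrite ex.
  have uy : u = center.
    have [//|[u1 _]] := D_adj Du; case: xu => + _.
    by rewrite x1 u1 => -[] [].
  have vy : v = center.
    have [//|[v1 _]] := D_adj Dv; case: xv => + _.
    by rewrite x1 v1 => -[] [].
  have := congr1 fst e; rewrite uy vy => e1.
  have {e1} : coset_act k (Some (coset M 1)) = Some (coset M 1) := e1.
  rewrite coset_actE mulg1 => -[/esym/(coset_eq Msg)].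
  by rewrite invg1 mul1g => Mk'; apply: (D_key Dx Dx).
have Ng_sub x : piece_stab x `<=` H by move=> k [].
have Ng_fix x k : piece_stab x k -> star_act k x = x by case.
have fg : H `<=` generated [set` s] by rewrite -HE.
have gs : [set` s] `<=` H by move=> x sx; rewrite HE; apply: mem_generated.
have key := @two_factor_hom F _ star_act F_li star_actP adjw Tb H Hsg
  (fun g x y Hg => @star_act_adj a b H M Hsg g x y Hg) piece_stab piece_stab_sg Ng_sub Ng_fix D
  D_conn D_free Hw s fg gs.
case: Hn => [ny|[w' [Dw' ww'] nw']].
  exact: (key _ _ _ _ _ Hr Dw D_y0 wy0 nm m1 ny n1).
exact: (key _ _ _ _ _ Hr Dw Dw' (nesym ww') nm m1 nw' n1).
Qed.

End Factors.

(** Collapsing the components of [dead] leaves a tree with one orbit of edges. If some [t] takes the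
    component of [a] to that of [b], then [H] is the free product of the stabilizer of the first and
    the group generated by [t]; otherwise it is the free product of the two stabilizers. *)
Lemma generated_split : (exists2 t, H t & H `<=` generated [set t]) \/
  exists phi : F -> Z,
  [/\ zhom_on H phi, phi r = 0%Z & exists2 f, H f & phi f <> 0%Z].
Proof.
have [[t Ht bta]|nt] := pselect (exists2 t, H t & conn (dead a b H) b (act t a)).
  pose M := generated [set t].
  have Msg : is_subgroup M by apply: is_subgroup_generated.
  have Mt : M t by apply: mem_generated.
  have MH : M `<=` H by apply: generated_min => // _ ->.
  pose E u v := adj u v /\ forall f, H f -> edge_at a b f u v -> M f.
  have Esym u v : E u v -> E v u.
    by case=> /Vt.1 vu EM; split=> // f Hf /edge_atC; apply: EM.
  have EM m u v : M m -> conn E u v -> conn E (act m u) (act m v).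
    move=> Mm; apply: (conn_map (h := act m)) => x y [xy EM]; apply: conn1.
    split=> [|f Hf /edge_at_act e]; first exact: act_adj.
    have Mf : M (m^-1 * f).
      by apply: EM e; apply: (sgM Hsg) => //; apply: (sgV Hsg); apply: MH.
    by have := sgM Msg Mm Mf; rewrite mulgA mulgV mul1g.
  have M_conn m : M m -> conn E a (act m a).
    move=> Mm; suff [] : M m /\ conn E a (act m a) by [].
    apply: (@generated_min _ _ [set m | M m /\ conn E a (act m a)]) Mm.
      apply: is_subgroupI => /= [|x [Mx cx]|x y [Mx cx] [My cy]].
      - by rewrite actP.1; split; [apply: (sg1 Msg)|apply: conn0].
      - have Mx' := sgV Msg Mx; split=> //.
        by have := EM _ _ _ Mx' (conn_sym Esym cx); rewrite actK.
      - split; first exact: (sgM Msg).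
        by rewrite actP.2; apply: conn_trans cx (EM _ _ _ Mx cy).
    move=> _ ->; split=> //.
    have Eab : E a b.
      split=> // f Hf e; have <- : 1 = f; last exact: (sg1 Msg).
      by apply: (edge_at_uniq ab _ e); left; rewrite !actP.1.
    apply: conn_trans (conn1 Eab) _; apply: sub_conn bta => u v [uv nH].
    by split=> // f Hf /(nH f Hf).
  pose x := dead_piece M a; pose y := center M.
  pose D := [set w | w = y \/ w = x].
  have xy : x <> y by [].
  have xNy : star_adj a b H M x y by split; [left|exists a].
  have D_adj w : D w -> w = y \/ w.1 = None /\ star_adj a b H M w y.
    by case=> ->; [left|right].
  have D_key u v n : D u -> D v -> u.1 = None -> v.1 = None -> M n ->
      star_act n u = v -> n = 1.
    case=> ->; first by [].
    case=> ->; first by [].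
    move=> _ _ Mn e; have Hn := MH _ Mn.
    have c := (@star_act_dead a b H M Hsg n a Hn).1 e.
    apply: (cyclic_conn deadC _ _ Mn c); first by move=> u' v'; apply: dead_act.
    by move=> k w; apply: translate_dead.
  have Ngx n : H n -> conn (dead a b H) a (act n a) -> piece_stab M x n.
    exact: piece_stab_dead.
  have Ngy n : M n -> piece_stab M y n by apply: center_stab.
  pose N := word_group (piece_stab M) D.
  have Nsg : is_subgroup N by apply: is_subgroup_generated.
  have Nx n : H n -> conn (dead a b H) a (act n a) -> N n.
    by move=> Hn c; apply: mem_generated; exists x; [right|apply: Ngx].
  have Ny n : M n -> N n.
    by move=> Mn; apply: mem_generated; exists y; [left|apply: Ngy].
  have NH : N `<=` H by apply: generated_min => // n [w _ []].
  (* Translation by [N] brings every vertex into the component of [a]: the crossing of an orbit edge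
     is undone by a stabilizing element together with [t] or its inverse. *)
  have reach v : conn adj a v -> exists2 n, N n & conn (dead a b H) a (act n v).
    elim=> [|u w _ [n Nn c] uw].
      by exists 1; [apply: (sg1 Nsg)|rewrite actP.1; apply: conn0].
    have Hn := NH _ Nn.
    have [[g [Hg [[eu ew]|[eu ew]]]]|ne] :=
        pselect (exists g, H g /\ edge_at a b g u w).
    - have Hng := sgM Hsg Hn Hg; have Nng : N (n * g) by apply: Nx; rewrite // actP.2 -eu.
      exists (t^-1 * ((n * g)^-1 * n)).
        apply: (sgM Nsg); first exact: (sgV Nsg (Ny _ Mt)).
        by apply: (sgM Nsg) => //; apply: (sgV Nsg).
      rewrite ew -actP.2 invgM -!mulgA mulKg mulVg mulg1.
      have := dead_mul (sgV Hsg Ht) bta; rewrite actK //.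
      exact: conn_sym.
    - have Hng := sgM Hsg Hn Hg; have Hngt := sgM Hsg Hng Ht.
      have Nngt : N (n * g * t).
        apply: Nx => //; rewrite !actP.2; rewrite eu in c; apply: conn_trans c _.
        by rewrite -!actP.2 -[_ * t]mulgA !actP.2; apply: dead_mul => //; apply: dead_mul.
      exists (t * ((n * g * t)^-1 * n)).
        by apply: (sgM Nsg); [apply: Ny|apply: (sgM Nsg) => //; apply: (sgV Nsg)].
      by rewrite ew -actP.2 !invgM -!mulgA mulKg mulVg mulg1 mulgV actP.1; apply: conn0.
    - exists n => //; apply: conn_trans c _; apply: dead_mul => //; apply: conn1.
      by split=> // f Hf e; apply: ne; exists f.
  have HN : H `<=` N.
    move=> f Hf; have [n Nn c] := reach _ (Vconn a (act f a)).
    have Nnf : N (n * f) by apply: Nx; [apply: (sgM Hsg) => //; apply: NH|rewrite actP.2].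
    by have := sgM Nsg (sgV Nsg Nn) Nnf; rewrite mulKg.
  have [[m [nm m1]]|triv] := pselect (exists m, piece_stab M x m /\ m <> 1).
    right; apply: (@factors_hom M Msg D _ D_adj D_key x m t) => //; first by left.
    - by right.
    - by left; apply: Ngy.
    - move=> t1; apply: ab_dead; move: bta; rewrite t1 actP.1.
      exact: conn_sym.
  left; exists t => // f /HN.
  apply: generated_min => // n [w [->|->]]; last first.
    move=> nx; have -> : n = 1; last exact: (sg1 Msg).
    by apply: contrapT => n1; apply: triv; exists n.
  by case=> _ _; apply.
(* With [M] trivial each leaf of the star stands for one edge of the orbit, and [center] for [a b]
   itself. *)
right; pose M : set F := [set 1].
have Msg : is_subgroup M by split=> // u v -> ->; rewrite /M /= mulgV.
have MH : M `<=` H by move=> _ ->; apply: (sg1 Hsg).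
pose x := dead_piece M a; pose z := dead_piece M b; pose y := center M.
have ynone w : w = y -> w.1 = None -> False by move=> ->.
pose D := [set w | w = y \/ w = x \/ w = z].
have nbt n : H n -> ~ conn (dead a b H) b (act n a) by move=> Hn c; apply: nt; exists n.
have nat n : H n -> ~ conn (dead a b H) a (act n b).
  move=> Hn c; apply: (nbt n^-1); first exact: (sgV Hsg).
  by have := dead_mul (sgV Hsg Hn) c; rewrite actK //; apply: conn_sym.
have ycomp : star_comp a b H M (Some (coset M 1)) a = star_comp a b H M (Some (coset M 1)) b.
  apply/star_comp_eq/conn1/lvl_coset => //; split=> // f Hf e.
  by apply/esym; apply: (edge_at_uniq ab _ e); left; rewrite !actP.1.
have D_adj w : D w -> w = y \/ w.1 = None /\ star_adj a b H M w y.
  case=> [->|[]->]; [by left|right|right]; split=> //; split; try by left.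
    by exists a.
  by exists b; split=> //; apply: ycomp.
have D_key u v n : D u -> D v -> u.1 = None -> v.1 = None -> M n ->
    star_act n u = v -> n = 1 by [].
have xz : x <> z.
  by move=> /(congr1 snd)/star_comp_eq c; apply: ab_dead; apply: sub_conn c => u v /lvl_None.
pose N := word_group (piece_stab M) D.
have Nsg : is_subgroup N by apply: is_subgroup_generated.
have Nx n : H n -> conn (dead a b H) a (act n a) -> N n.
  move=> Hn c; apply: mem_generated; exists x; first by right; left.
  exact: piece_stab_dead.
have Nz n : H n -> conn (dead a b H) b (act n b) -> N n.
  move=> Hn c; apply: mem_generated; exists z; first by right; right.
  exact: piece_stab_dead.
have NH : N `<=` H by apply: generated_min => // n [w _ []].
have reach v : conn adj a v -> exists2 n, N n &
    conn (dead a b H) a (act n v) \/ conn (dead a b H) b (act n v).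
  elim=> [|u w _ [n Nn c] uw].
    by exists 1; [apply: (sg1 Nsg)|rewrite actP.1; left; apply: conn0].
  have Hn := NH _ Nn.
  have [[g [Hg e]]|ne] := pselect (exists g, H g /\ edge_at a b g u w); last first.
    have c' : conn (dead a b H) (act n u) (act n w).
      apply: dead_mul => //; apply: conn1.
      by split=> // f Hf e; apply: ne; exists f.
    by exists n => //; case: c => c; [left|right]; apply: conn_trans c c'.
  have Hng := sgM Hsg Hn Hg.
  have back p : act ((n * g)^-1 * n) (act g p) = p.
    by rewrite -actP.2 invgM -!mulgA mulKg mulVg actP.1.
  have Nback : N (n * g) -> N ((n * g)^-1 * n).
    by move=> Nng; apply: (sgM Nsg) => //; apply: (sgV Nsg).
  case: e c => -[-> ->]; rewrite -actP.2 => -[] c.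
  - by exists ((n * g)^-1 * n); rewrite ?back; [apply: Nback; apply: Nx|right; apply: conn0].
  - by case: (nbt _ Hng).
  - by case: (nat _ Hng).
  - by exists ((n * g)^-1 * n); rewrite ?back; [apply: Nback; apply: Nz|left; apply: conn0].
have HN : H `<=` N.
  move=> f Hf; have [n Nn c] := reach _ (Vconn a (act f a)).
  have Hnf : H (n * f) by apply: (sgM Hsg) => //; apply: NH.
  have Nnf : N (n * f).
    by case: c => c; [apply: Nx; rewrite // actP.2|case: (nbt _ Hnf); rewrite actP.2].
  by have := sgM Nsg (sgV Nsg Nn) Nnf; rewrite mulKg.
(* Were one factor trivial, [H] would stabilize the component at the other end, against [r_dead]. *)
have nontriv d p : (forall w, D w -> w = y \/ w = d \/ w = dead_piece M p) ->
    exists m, piece_stab M d m /\ m <> 1.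
  move=> Dd; apply: contrapT => triv; apply: (r_dead (v := p)).
  have HS : H `<=` piece_stab M (dead_piece M p).
    move=> f /HN; apply: generated_min; first exact: piece_stab_sg.
    move=> n [w /Dd [->|[->|->]]] //.
      by case=> _ _ -> //; apply: (sg1 (piece_stab_sg Msg _)).
    move=> nd; have -> : n = 1; last exact: (sg1 (piece_stab_sg Msg _)).
    by apply: contrapT => n1; apply: triv; exists n.
  by have [_ e _] := HS _ Hr; apply: (@star_act_dead a b H M Hsg r p Hr).1.
have [m [nm m1]] := nontriv x b (fun _ => id).
have [n [nn n1]] : exists m, piece_stab M z m /\ m <> 1.
  by apply: (nontriv z a) => w [->|[->|->]]; [left|right; right|right; left].
apply: (@factors_hom M Msg D _ D_adj D_key x m n) => //; first by left.
- by right; left.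
- by right; exists z; [split; [right; right|apply/nesym]|].
Qed.

End Splitting.

Lemma seq_min (T : eqType) (f : T -> Z) (s : seq T) x0 : x0 \in s ->
  exists2 x, x \in s & forall y, y \in s -> (f x <= f y)%Z.
Proof.
elim: s x0 => [//|x s IH] x0 _; case: s IH => [|y s] IH.
  by exists x; rewrite ?mem_head // => y; rewrite inE => /eqP ->; lia.
have [z zs zmin] := IH y (mem_head _ _).
have [xz|zx] := Z.le_ge_cases (f x) (f z).
  exists x; first exact: mem_head.
  by move=> w; rewrite inE => /predU1P[->|/zmin]; lia.
exists z; first by rewrite inE zs orbT.
by move=> w; rewrite inE => /predU1P[->//|/zmin].
Qed.

Section Main.
Hypothesis F_li : locally_indicable F.

Theorem relator_tree q : forall (H : set F) (r : F) (v0 a b : V),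
  is_subgroup H -> H r -> on_axis r v0 -> adj a b ->
  sep adj a b v0 (act r v0) ->
  (exists s : seq F, (size s < q)%N /\
     forall f, H f -> esep a b v0 (act r v0) f -> f \in s) ->
  Wh (rel_conj H r) /\
  forall n v, generated (rel_conj H r) n -> conn (dead a b H) v (act n v) -> n = 1.
Proof.
elim: q => [|q IHq] H r v0 a b Hsg Hr ax ab sab [s [sz sP]]; first by [].
pose L := [seq f <- s | `[< H f /\ esep a b v0 (act r v0) f >]].
have LP f : f \in L <-> H f /\ esep a b v0 (act r v0) f.
  rewrite mem_filter; split; first by case/andP => /asboolP.
  by move=> [Hf sf]; apply/andP; split; [apply/asboolP|apply: sP].
pose F0 := generated [set` r :: L].
have Fsg : is_subgroup F0 by apply: is_subgroup_generated.
have gF0 f : f \in r :: L -> F0 f by move=> fL; apply: mem_generated.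
have FH : F0 `<=` H.
  by apply: generated_min => // f /=; rewrite inE => /predU1P[->//|/LP[]].
have Fr : F0 r by apply: gF0; apply: mem_head.
have FL f : f \in L -> F0 f by move=> fL; apply: gF0; rewrite inE fL orbT.
have esep1 : esep a b v0 (act r v0) 1 by rewrite /esep !actP.1.
have L1 : 1 \in L by apply/LP; split=> //; apply: (sg1 Hsg).
have key : Wh (rel_conj F0 r) /\ forall n v, generated (rel_conj F0 r) n ->
    conn (dead a b F0) v (act n v) -> n = 1.
  have r_dead v : ~ conn (dead a b F0) v (act r v).
    by move=> c; have /= := axis_dead (j := 1) Fsg Fr ax ab sab c.
  have [[t Ft F0t]|[phi [phiM phi_r [f1 Ff1 phif1]]]] :=
      generated_split F_li ab erefl Fr r_dead.
    (* A cyclic group is commutative, so [r] is its own only conjugate. *)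
    have rE : rel_conj F0 r = [set r].
      have comm : F0 `<=` [set f | commute r f].
        have ct : generated [set t] `<=` [set f | commute t f].
          apply: generated_min => [|_ ->]; last exact: commute_refl.
          apply: is_subgroupI => [|x|x y] /=; first exact: commute1.
            exact: commuteV.
          exact: commuteM.
        have ctr : commute t r := ct r (F0t r Fr).
        move=> f /F0t; apply: generated_min => [|_ ->]; last exact: commute_sym.
        apply: is_subgroupI => [|x|x y] /=; first exact: commute1.
          exact: commuteV.
        exact: commuteM.
      apply/seteqP; split=> y; last first.
        by move=> ->; exists 1; [apply: (sg1 Fsg)|rewrite mul1g invg1 mulg1].
      by case=> f /comm cf ->; rewrite -cf mulgK.
    rewrite rE; split; first by apply: Wh_cyclic; apply: axis_inf ax ab sab.
    move=> n v nn; apply: cyclic_conn nn.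
    + by move=> x y; apply: dead_sym.
    + by move=> x y; apply: dead_act.
    + by move=> k w; apply: axis_dead ax ab sab.
  have [llo loL lomin] := seq_min phi L1.
  have [lhi hiL himax] := seq_min (fun f => - phi f)%Z L1.
  have phi1 : phi 1 = 0%Z by apply: zhom_on1 phiM.
  (* If [phi] vanished on [L] it would vanish on [F0]. As [1] lies in [L] at height 0, the two
     extremes differ. *)
  have [l2 l2L phil2] : exists2 l, l \in L & phi l <> 0%Z.
    apply: contrapT => no; apply: phif1.
    suff [] : F0 f1 /\ phi f1 = 0%Z by [].
    apply: (@generated_min _ _ [set f | F0 f /\ phi f = 0%Z]) Ff1.
      exact: zhom_on_ker.
    move=> f /=; rewrite inE => /predU1P[->//|fL]; split; first exact: FL.
    by apply: contrapT => nf; apply: no; exists f.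
  have lo_hi : (phi llo < phi lhi)%Z.
    have := lomin _ L1; have := lomin _ l2L; have := himax _ L1; have := himax _ l2L.
    by rewrite phi1; lia.
  have phiV f : F0 f -> phi f^-1 = (- phi f)%Z.
    move=> Ff; have := phiM _ _ (sgV Fsg Ff) Ff; rewrite mulVg phi1; lia.
  apply: (@relator_kernel a b v0 F0 r phi (phi llo) (phi lhi) ab Fsg Fr phiM phi_r
    lo_hi _ llo lhi (FL _ loL) (FL _ hiL) erefl erefl).
    move=> f Ff sf; have fL : f \in L by apply/LP; split=> //; apply: FH.
    by have := lomin _ fL; have := himax _ fL; lia.
  move=> f M l Ff Msg MF0 Mphi Mr El.
  have lL : l \in L by case: El => ->.
  have Fl := FL _ lL; have Ffl := sgM Fsg Ff Fl.
  have ef v : act (f * r * f^-1) (act f v) = act f (act r v) by rewrite !actP.2 actK.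
  have sl : sep adj (act (f * l) a) (act (f * l) b) (act f v0)
      (act (f * r * f^-1) (act f v0)).
    by rewrite ef !(actP.2 f l); apply: sep_act => //; have [_] := (LP l).1 lL.
  apply: (IHq M _ (act f v0)) => //.
  + exact: on_axis_conj.
  + exact: act_adj.
  (* A separating translate by [m] in [M] pulls back under [f] to an element of [s] at height
     [phi l], as [phi] vanishes on [M]. The other extreme drops out, so the list gets shorter. *)
  exists [seq f * x * l^-1 * f^-1 | x <- s & `[< phi x = phi l >]]; split.
    rewrite size_map size_filter; apply: leq_trans (_ : (_ <= size s)%N) sz.
    have [l' l's ne] : exists2 l', l' \in s & phi l' <> phi l.
      case: El => ->; [exists lhi|exists llo]; try lia.
        by move: hiL; rewrite mem_filter => /andP[].
      by move: loL; rewrite mem_filter => /andP[].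
    rewrite -(count_predC (fun x => `[< phi x = phi l >]) s) -addn1 leq_add2l.
    by rewrite -has_count; apply/hasP; exists l' => //=; apply/asboolPn.
  move=> m Mm; rewrite /esep -!(actP.2 m) ef => sm.
  have Fm := MF0 _ Mm.
  have Fx : F0 (f^-1 * (m * (f * l))).
    by apply: (sgM Fsg); [apply: (sgV Fsg)|apply: (sgM Fsg)].
  apply/mapP; exists (f^-1 * (m * (f * l))).
    rewrite mem_filter; apply/andP; split.
      have Fi := sgV Fsg Ff; have Fmfl := sgM Fsg Fm Ffl.
      by apply/asboolP; rewrite !phiM // phiV // (Mphi m) //; lia.
    by apply: sP; [apply: FH|apply: esep_act].
  by rewrite !mulgA mulgV mul1g mulgK mulgK.
apply: (relator_extend (v0 := v0) (F0 := F0)) => //.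
- pose E u v := adj u v /\ forall g, H g -> edge_at a b g u v -> F0 g.
  have Esym u v : E u v -> E v u.
    by case=> /Vt.1 vu EM; split=> // f Hf /edge_atC; apply: EM.
  have EF m u v : F0 m -> conn E u v -> conn E (act m u) (act m v).
    move=> Fm; apply: (conn_map (h := act m)) => x y [xy EM]; apply: conn1.
    split=> [|f Hf /edge_at_act e]; first exact: act_adj.
    have Ff : F0 (m^-1 * f).
      by apply: EM e; apply: (sgM Hsg) => //; apply: (sgV Hsg); apply: FH.
    by have := sgM Fsg Fm Ff; rewrite mulgA mulgV mul1g.
  have Eadj u v : E u v -> adj u v by case.
  (* The [H]-translates of the edge between [v0] and [act r v0] come from [L], hence from [F0]. *)
  have Er : conn E v0 (act r v0).
    apply: contrapT => nc.
    have [p [q' [pq nE _ spq]]] := sep_exists Vt Eadj (Vconn _ _) nc.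
    apply: nE; split=> // g Hg e; apply: FL; apply/LP; split=> //.
    exact: esep_edge_at e spq.
  have Ef f : f \in L -> conn E v0 (act f a).
    case/LP => Hf sf; have [c|//] := conn_cut_or (act f a) (act f b) Eadj Er.
    by case: sf.
  have Ea : conn E v0 a by have := Ef _ L1; rewrite actP.1.
  move=> f Ff; suff [] : F0 f /\ conn E v0 (act f v0) by [].
  apply: (@generated_min _ _ [set f | F0 f /\ conn E v0 (act f v0)]) Ff.
    apply: is_subgroupI => /= [|x [Fx cx]|x y [Fx cx] [Fy cy]].
    + by rewrite actP.1; split; [apply: (sg1 Fsg)|apply: conn0].
    + have Fx' := sgV Fsg Fx; split=> //.
      by have := EF _ _ _ Fx' (conn_sym Esym cx); rewrite actK.
    + split; first exact: (sgM Fsg).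
      by rewrite actP.2; apply: conn_trans cx (EF _ _ _ Fx cy).
  move=> g /=; rewrite inE => /predU1P[->//|gL]; split; first exact: FL.
  exact: conn_trans (Ef _ gL) (conn_sym Esym (EF _ _ _ (FL _ gL) Ea)).
- exact: key.1.
- exact: key.2.
Qed.

End Main.

End FreeTree.

(** * Axes, centralizers, and the theorem *)

Section Axis.
Variables (F : groupType) (V : Type) (act : F -> V -> V) (adj : V -> V -> Prop).
Hypothesis actP : is_left_action act.
Hypothesis Vt : bridged adj.
Hypothesis Vconn : forall u v, conn adj u v.
Hypothesis act_adj : forall f u v, adj u v -> adj (act f u) (act f v).
Hypothesis act_noinv : forall f u v, adj u v -> act f u = v -> act f v = u -> False.

Fixpoint walk n (u v : V) : Prop :=
  if n is n'.+1 then exists2 w, adj u w & walk n' w v else u = v.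

Lemma walk_cat m n u v w : walk m u v -> walk n v w -> walk (m + n) u w.
Proof.
elim: m u => [|m IH] u /=; first by move=> ->.
by case=> x ux xv /(IH _ xv) xw; exists x.
Qed.

Lemma walk_rcons n u v : walk n.+1 u v -> exists2 w, walk n u w & adj w v.
Proof.
elim: n u => [|n IH] u [w uw wv]; first by exists u => //; rewrite -wv.
by have [x wx xv] := IH _ wv; exists x => //; exists w.
Qed.

Lemma conn_walk u v : conn adj u v -> exists n, walk n u v.
Proof.
elim=> [|x y _ [n ux] xy]; first by exists 0%N.
by exists (n + 1)%N; apply: walk_cat ux _; exists y.
Qed.

Lemma walk_off n u v x : walk n u v ->
  (exists k, (k <= n)%N /\ walk k u x) \/ conn (off adj x) u v.
Proof.
elim: n u => [|n IH] u /=; first by move=> ->; right; apply: conn0.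
case=> w uw /IH[[k [kn wx]]|c].
  by left; exists k.+1; split=> //; exists w.
have [e|ux] := pselect (u = x); first by left; exists 0%N.
have [e|wx] := pselect (w = x).
  by left; exists 1%N; split=> //; exists w.
right; apply: conn_trans c; exact: conn1.
Qed.

Lemma sep_dir p q c y v : adj c y -> conn (off adj c) y v -> sep adj p q c v ->
  is_edge p q c y \/ conn (off adj c) y p.
Proof.
move=> cy yv s; have [|ne] := pselect (is_edge p q c y); [by left|right].
have oadj s' t : off adj c s' t -> adj s' t by case.
have [yv'|//] := conn_cut_or p q oadj yv.
by case: s; apply: conn_trans yv'; apply: conn1.
Qed.

(* A vertex of minimal displacement lies on the axis. *)
Lemma on_axis_exists (v1 : V) r : (forall v, act r v <> v) ->
  exists v0, on_axis act adj r v0.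
Proof.
move=> r_fix.
have ex : exists n, `[< exists v, walk n v (act r v) >].
  by have [n nw] := conn_walk (Vconn v1 (act r v1)); exists n; apply/asboolP; exists v1.
case: (ex_minnP ex) => n /asboolP[v vw] nmin; exists v.
have {}nmin k u : walk k u (act r u) -> (n <= k)%N.
  by move=> uw; apply: nmin; apply/asboolP; exists u.
case: n vw nmin => [|n] vw nmin; first by case: (r_fix v); rewrite -vw.
have [w vw' wr] := vw.
(* [y] is the last vertex before [act r v]. If it were [act r w], then [w] would be displaced less
   than [v], or, at displacement 1, [r] would invert an edge. *)
have [y [vy yr yw]] : exists y, [/\ walk n v y, adj y (act r v) & y <> act r w].
  case: n vw nmin wr => [|n] vw nmin wr.
    exists v; rewrite -wr; split=> // e.
    by apply: (act_noinv vw' (esym wr)); rewrite -e.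
  have [y wy yr] := walk_rcons wr; exists y; split=> //; first by exists w.
  by move=> e; rewrite e in wy; have := nmin _ _ wy; rewrite ltnNge leqnSn.
have walk_act k u u' : walk k u u' -> walk k (act r u) (act r u').
  elim: k u => [|k IH] u /=; first by move=> ->.
  by case=> x ux /IH xu; exists (act r x) => //; apply: act_adj.
have yv : conn (off adj (act r v)) y v.
  apply: (conn_sym (@off_sym _ _ Vt (act r v))).
  have [[k [kn vk]]|//] := walk_off (act r v) vy.
  by have := leq_trans (nmin _ _ vk) kn; rewrite ltnn.
have wrv : conn (off adj v) w (act r v).
  apply: (conn_sym (@off_sym _ _ Vt v)).
  have walk_sym k : forall u u', walk k u u' -> walk k u' u.
    elim: k => [|k IH] u u'; first by move=> /= ->.
    by case=> x ux /IH xu; rewrite -addn1; apply: walk_cat xu _; exists u => //; apply: Vt.1.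
  have [[k [kn vk]]|//] := walk_off v (walk_sym _ _ _ wr).
  by have := leq_trans (nmin _ _ (walk_sym _ _ _ vk)) kn; rewrite ltnn.
have cw : adj (act r v) (act r w) by apply: act_adj.
have cy : adj (act r v) y by apply: Vt.1.
have rwv : conn (off adj (act r v)) (act r w) (act r (act r v)).
  apply: (conn_map (h := act r)) wrv => s t [st sv tv]; apply: conn1.
  by split; [apply: act_adj|move/(act_inj actP)|move/(act_inj actP)].
have noff u : adj (act r v) u -> ~ conn (off adj (act r v)) u (act r v).
  by move=> cu /(off_neq (nesym (adj_neq Vt cu))).
have nyw : ~ conn (off adj (act r v)) y (act r w).
  by move=> /(dir_uniq Vt cy cw).
have offC := @off_sym _ _ Vt (act r v).
(* Such an edge would lie both in the direction [y] and in the direction [act r w] at [act r v], and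
   these differ. *)
move=> p q pq s1 s2.
have [e1|c1] := sep_dir cy yv (sepCr Vt s1); have [e2|c2] := sep_dir cw rwv s2.
- case: e1 e2 => -[e1 e2] [] [e3 e4].
  + by apply: yw; rewrite e2 e4.
  + by apply: (adj_neq Vt pq); rewrite -e1 -e3.
  + by apply: (adj_neq Vt pq); rewrite -e1 -e3.
  + by apply: yw; rewrite e2 e4.
- case: e1 => -[e1 e2]; first by apply: (noff _ cw); rewrite [X in conn _ _ X]e1.
  by apply: nyw; rewrite e2; apply: conn_sym c2.
- case: e2 => -[e1 e2]; first by apply: (noff _ cy); rewrite [X in conn _ _ X]e1.
  by apply: nyw; rewrite e2.
- by apply: nyw; apply: conn_trans c1 (conn_sym offC c2).
Qed.

End Axis.

Section Centralizer.
Variables (F : groupType) (V : Type) (act : F -> V -> V) (adj : V -> V -> Prop).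
Hypothesis actP : is_left_action act.
Hypothesis Vt : bridged adj.
Hypothesis Vconn : forall u v, conn adj u v.
Hypothesis act_adj : forall f u v, adj u v -> adj (act f u) (act f v).
Hypothesis act_free : forall f u v, adj u v -> act f u = u -> act f v = v -> f = 1.
Hypothesis act_noinv : forall f u v, adj u v -> act f u = v -> act f v = u -> False.
Hypothesis F_li : locally_indicable F.
Variables (r : F) (v0 : V).
Hypothesis ax : on_axis act adj r v0.

Let C : set F := [set f | commute r f].

Let Csg : is_subgroup C.
Proof.
apply: is_subgroupI => [|x|x y]; [exact: commute1|exact: commuteV|exact: commuteM].
Qed.

Let Cr : C r. Proof. exact: commute_refl. Qed.

(* Every translate of the edge by [C] lies on the axis of [r], hence is moved
   by a power of [r] between [v0] and [r v0]. *)
Let C_reduce a b c : adj a b -> sep adj a b v0 (act r v0) -> C c -> exists g l, [/\ generated [set r] g, C l,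
  esep act adj a b v0 (act r v0) l & c = g * l].
Proof.
move=> ab sab Cc; wlog nS : a b ab sab / ~ side adj a b v0.
  move=> IH; have [S0|] := pselect (side adj a b v0); last exact: IH.
  have S0' : ~ side adj b a v0.
    move=> S0'; apply: (Vt.2 _ _ ab).
    exact: conn_trans (conn_cut_flip S0') (conn_cutC Vt S0).
  have [g [l [gr Cl sl e]]] := IH b a (Vt.1 _ _ ab) (sepC sab) S0'.
  by exists g, l; split=> //; apply: sepC.
have Sr : side adj a b (act r v0).
  apply: contrapT => nSr; apply: sab.
  exact: (sideC_conn Vt (Vconn _ _) (Vconn _ _) nS nSr).
have Sstep := axis_side actP Vt act_adj ax ab nS Sr.
have cab : adj (act c a) (act c b) by apply: act_adj.
pose S x := side adj (act c a) (act c b) x.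
have SE x : S x <-> side adj a b (act c^-1 x).
  split=> [/(side_act actP act_adj c^-1)|/(side_act actP act_adj c)].
    by rewrite !actK.
  by rewrite actVK.
have crx x : act c^-1 (act r x) = act r (act c^-1 x).
  have cc : commute r c^-1 by apply: commuteV.
  by rewrite -!actP.2 cc.
have cSstep x : S x -> S (act r x) by rewrite !SE crx; apply: Sstep.
have Sp : S (act c (act r v0)) by rewrite SE actK.
have nSp : ~ S (act r^-1 (act c (act r v0))).
  rewrite SE; have -> : act c^-1 (act r^-1 (act c (act r v0))) = v0.
    rewrite -!actP.2 (_ : _ * _ = 1) ?actP.1 // -!mulgA.
    by rewrite -[c * r]Cc mulKg mulVg.
  exact: nS.
have [m nSm] := halfspace_escape actP Vt Vconn act_adj cab cSstep Sp nSp v0.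
set x := act _ v0 in nSm.
have [k Sk] := halfspace_enter actP Vt Vconn act_adj cab cSstep Sp nSp x.
have [j [nSj Sj]] : exists j, ~ S (act (r ^+ j) x) /\ S (act (r ^+ j.+1) x).
  elim: k Sk => [|k IH] Sk; first by case: nSm; move: Sk; rewrite actP.1.
  by have [/IH//|nSk] := pselect (S (act (r ^+ k) x)); exists k.
pose g := r ^+ j * (r ^+ m)^-1.
have rsg := is_subgroup_generated [set r].
have gr : generated [set r] g.
  have rr : generated [set r] r by apply: mem_generated.
  by apply: (sgM rsg); [apply: (sgX _ rsg)|apply: (sgV rsg); apply: (sgX _ rsg)].
have Cg : C g by apply: generated_min gr => // _ ->.
exists g, (g^-1 * c); split=> //; last by rewrite mulgA mulgV mul1g.
  by apply: (sgM Csg) => //; apply: (sgV Csg).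
have eg : act g v0 = act (r ^+ j) x by rewrite actP.2.
have egr : act g (act r v0) = act (r ^+ j.+1) x.
  by rewrite -actP.2 -Cg actP.2 eg -actP.2 -expgS.
apply: (esep_act actP act_adj).
by rewrite /esep eg egr => /(side_conn_eq Vt) H; apply: nSj; apply/H.
Qed.

Lemma centralizer_cyclic a b : adj a b -> sep adj a b v0 (act r v0) ->
  exists2 t, C t & C `<=` generated [set t].
Proof.
move=> ab sab; have red c := @C_reduce a b c ab sab.
have [s sP] := finite_esep actP Vconn act_adj act_free act_noinv ab v0 (act r v0).
pose L := [seq f <- s | `[< C f >]].
have LP f : f \in L <-> C f /\ f \in s.
  rewrite mem_filter; split; first by case/andP => /asboolP.
  by move=> [Cf fs]; apply/andP; split=> //; apply/asboolP.
have CE : C = generated [set` r :: L].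
  have gsg := is_subgroup_generated [set` r :: L].
  apply/seteqP; split=> [c /red[g [l [gr Cl /sP ls ->]]]|].
    apply: (sgM gsg); last by apply: mem_generated; rewrite /= inE; apply/orP; right; apply/LP.
    apply: generatedS gr => _ ->; exact: mem_head.
  by apply: generated_min => // f /=; rewrite inE => /predU1P[->//|/LP[]].
have r_dead v : ~ conn (dead act adj a b C) v (act r v).
  by move=> c; have /= := axis_dead actP Vt Vconn act_adj Csg Cr ax ab sab (j := 1) c.
have [//|[phi [phiM phi_r [f Cf phif]]]] :=
  generated_split actP Vt Vconn act_adj act_free act_noinv F_li ab CE Cr r_dead.
exfalso.
have ker_r g : generated [set r] g -> phi g = 0%Z.
  move=> gr; suff [] : C g /\ phi g = 0%Z by [].
  apply: (@generated_min _ _ [set f | C f /\ phi f = 0%Z]) gr; first exact: zhom_on_ker.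
  by move=> _ ->.
have rC g : generated [set r] g -> C g by apply: generated_min => // _ ->.
have phiL c : C c -> exists2 l, l \in L & phi c = phi l.
  move=> /red[g [l [gr Cl /sP ls ->]]]; exists l; first exact/LP.
  by rewrite phiM ?(ker_r g) //; apply: rC.
have [l0 l0L _] := phiL _ Cr.
have [lo loL lomin] := seq_min phi l0L.
have [hi hiL himax] := seq_min (fun f => - phi f)%Z l0L.
have phiX n : phi (f ^+ n) = (Z.of_nat n * phi f)%Z.
  elim: n => [|n IH]; first by rewrite (zhom_on1 Csg phiM).
  by rewrite expgS phiM // ?IH; [lia|apply: (sgX _ Csg)].
(* An exponent too large for [phi (f ^+ n)] to lie between [phi lo] and [phi hi]. *)
pose n := Z.to_nat (Z.abs (phi lo) + Z.abs (phi hi) + 1)%Z.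
have [l lL e] := phiL _ (sgX n Csg Cf).
have h1 := lomin _ lL; have h2 := himax _ lL; rewrite phiX in e.
have en : Z.of_nat n = (Z.abs (phi lo) + Z.abs (phi hi) + 1)%Z.
  by rewrite /n; lia.
by rewrite en in e; nia.
Qed.

End Centralizer.

(** * From unique reduced paths to bridges *)

Section GraphTree.
Variable T : graph.
Hypothesis T_tree : is_tree T.

Definition gadj (u v : vertex T) : Prop :=
  exists d : dart T, dart_source d = u /\ dart_target d = v.

Fixpoint all_darts (P : dart T -> Prop) (p : seq (dart T)) : Prop :=
  if p is d :: p' then P d /\ all_darts P p' else True.

Lemma dart_source_inv (d : dart T) : dart_source (dart_inv d) = dart_target d.
Proof. by case: d => e []. Qed.

Lemma dart_target_inv (d : dart T) : dart_target (dart_inv d) = dart_source d.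
Proof. by case: d => e []. Qed.

(** Cancelling adjacent inverse darts introduces no new dart, so a path that avoids an edge reduces
    to one that still avoids it. *)
Lemma path_reduce v p w : is_path v p w -> exists p',
  [/\ is_path v p' w, reduced p' & forall P, all_darts P p -> all_darts P p'].
Proof.
elim: p v => [|d p IH] v /=; first by move=> ->; exists [::].
case=> dv /IH[p' [pw red sub]].
have [[p2 e]|ne] := pselect (exists p2, p' = dart_inv d :: p2).
  subst p'; exists p2; split.
  - by case: pw => _; rewrite dart_target_inv dv.
  - by case: p2 red {pw sub} => // d2 p2 [].
  - by move=> P [_ /sub[]].
exists (d :: p'); split=> //=; last by move=> P [Pd /sub].
case: p' red ne {pw sub} => // d2 p2 red ne; split=> // e.
by apply: ne; exists p2; rewrite e.
Qed.

Lemma dart_path_uniq (d : dart T) p :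
  is_path (dart_source d) p (dart_target d) -> reduced p -> p = [:: d].
Proof.
move=> pd red; have [p0 [_ uniq]] := T_tree.2 (dart_source d) (dart_target d).
by rewrite -(uniq _ (conj pd red)); apply: uniq.
Qed.

Lemma gadj_bridged : bridged gadj.
Proof.
split=> [u v [d [<- <-]]|u v [d [du dv]] c].
  by exists (dart_inv d); rewrite dart_source_inv dart_target_inv.
pose good (d : dart T) := ~ is_edge u v (dart_source d) (dart_target d).
(* The connection is unwound from its last step, so the darts already read accumulate in [p]. *)
have H x : conn (cut gadj u v) u x -> forall p, is_path x p v -> all_darts good p ->
    exists2 p', is_path u p' v & all_darts good p'.
  elim=> [|y z _ IH [[e [ey ez]] ne]] p pv gp; first by exists p.
  by apply: (IH (e :: p)); split=> //; rewrite ?ez // /good ey ez.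
have [p pv gp] := H v c [::] erefl I.
have [p' [pw red sub]] := path_reduce pv.
have e : p' = [:: d] by apply: dart_path_uniq => //; rewrite du dv.
by have := sub _ gp; rewrite e => -[]; rewrite /good du dv => ne _; apply: ne; left.
Qed.

Lemma gadj_conn u v : conn gadj u v.
Proof.
have [p [[pv _] _]] := T_tree.2 u v; elim: p u pv => [|d p IH] u /=.
  by move=> ->; apply: conn0.
case=> du /IH; apply: conn_trans; apply: conn1.
by exists d.
Qed.

End GraphTree.

Section ActionTree.
Variables (F : groupType) (T : action_tree F).
Hypothesis T_free : trivial_edge_stabilizers T.

Let dart_act (f : F) (d : dart T) : dart T := (edge_act f d.1, d.2).

Let dart_act_source f d : dart_source (dart_act f d) = vertex_act f (dart_source d).
Proof. by case: d => e []; rewrite /dart_source /= ?initial_act ?terminal_act. Qed.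

Let dart_act_target f d : dart_target (dart_act f d) = vertex_act f (dart_target d).
Proof. by case: d => e []; rewrite /dart_target /= ?initial_act ?terminal_act. Qed.

Lemma vertex_act_adj f (u v : vertex T) : gadj u v ->
  gadj (vertex_act f u) (vertex_act f v).
Proof.
by case=> d [<- <-]; exists (dart_act f d); rewrite dart_act_source dart_act_target.
Qed.

(** The dart and its image are both reduced paths from [u] to [v], hence equal. *)
Lemma vertex_act_free f (u v : vertex T) : gadj u v -> vertex_act f u = u ->
  vertex_act f v = v -> f = 1.
Proof.
case=> d [du dv] fu fv.
have := @dart_path_uniq _ (tree_is_tree T) d [:: dart_act f d].
rewrite /= dart_act_source dart_act_target du dv fu fv => /(_ (conj erefl erefl) I).
case: d {du dv} => e c [ee].
by have : [set f : F | edge_act f e = e] f by []; rewrite T_free.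
Qed.

(** Uniqueness makes the dart the reverse of its image, but the action keeps the orientation bit. *)
Lemma vertex_act_noinv f (u v : vertex T) : gadj u v -> vertex_act f u = v ->
  vertex_act f v = u -> False.
Proof.
case=> d [du dv] fu fv.
have := @dart_path_uniq _ (tree_is_tree T) d [:: dart_inv (dart_act f d)].
rewrite /= dart_source_inv dart_target_inv dart_act_source dart_act_target du dv fu fv.
by move=> /(_ (conj erefl erefl) I); case: d {du dv} => e [].
Qed.

End ActionTree.

Section SubgroupTransfer.
Variables (F : groupType) (H : subgroup F).

Lemma val_subgroup (x : H) : subgroup_set H (val x).
Proof. by case: x => x /= /set_mem. Qed.

Lemma subgroup_sub (f : F) : subgroup_set H f -> exists x : H, val x = f.
Proof. by move=> Hf; exists (SubgroupElt (mem_set Hf)). Qed.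

Lemma generated_val (A : set F) (x : H) : A `<=` subgroup_set H ->
  generated A (val x) -> generated ((val : H -> F) @^-1` A) x.
Proof.
move=> AH gx; have gsg := is_subgroup_generated ((val : H -> F) @^-1` A).
suff [y /val_inj <- //] : exists2 y : H, val y = val x &
  generated ((val : H -> F) @^-1` A) y.
apply: (@generated_min _ _ [set f | exists2 y : H, val y = f &
  generated ((val : H -> F) @^-1` A) y]) gx.
  apply: is_subgroupI => /= [|_ [y <- gy]|_ _ [y <- gy] [z <- gz]].
  - by exists 1; [|apply: (sg1 gsg)].
  - by exists y^-1; [|apply: (sgV gsg)].
  - by exists (y * z); [|apply: (sgM gsg)].
move=> f Af; have [y e] := subgroup_sub (AH _ Af); exists y => //.
by apply: mem_generated; rewrite /= e.
Qed.

End SubgroupTransfer.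

Lemma Whitehead_of_Wh (F : groupType) (r : F) : Wh (rel_conj [set: F] r) ->
  Cohen_Lyndon_aspherical r.
Proof.
case=> X [XY Xfree YX XC].
have YE : lconj_set setT [set r] = rel_conj [set: F] r.
  apply/seteqP; split=> y; first by case=> h _ [_ -> <-]; exists h.
  by case=> h _ ->; exists h => //; exists r.
rewrite /Cohen_Lyndon_aspherical YE; set Y := rel_conj _ r in XY YX XC *.
set N := generated_subgroup Y; pose v := val : N -> F.
have XN : X `<=` subgroup_set N by move=> x /XY; apply: mem_generated.
have NX (x : N) : generated X (val x).
  apply: (generated_min _ YX (val_subgroup x)); exact: is_subgroup_generated.
exists (v @^-1` X); split.
- move=> K f.
  (* [h] lifts the elements of the normal closure to the group [N] and is arbitrary elsewhere;
     composing with it turns [f] into a function on [F]. *)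
  have /choice[h hP] x : exists y : N, subgroup_set N x -> val y = x.
    have [/subgroup_sub[y e]|no] := pselect (subgroup_set N x); first by exists y.
    by exists 1.
  have [phi [phiM phiX]] := Xfree K (f \o h).
  have psiM : {morph (phi \o v) : x y / x * y}.
    by move=> x y /=; rewrite -phiM.
  pose mix := isMultiplicative.Build N K (phi \o v) psiM.
  pose psi : {multiplicative N -> K} := HB.pack (phi \o v) mix.
  have psiX x : X (v x) -> psi x = f x.
    by move=> Xx; rewrite /= phiX //=; congr f; apply: val_inj; apply: hP; apply: XN.
  exists psi; split=> [x|psi' psi'X x]; first exact: psiX.
  have hom1 (chi : {multiplicative N -> K}) : hom_on [set: N] chi.
    by move=> y z _ _; apply: gmulfM.
  have Tsg : is_subgroup [set: N] by [].
  apply: (@generated_min _ _ [set x | psi' x = psi x] _ _ _ (generated_val XN (NX x))).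
    apply: is_subgroupI => [|y e|y z ey ez].
    + exact: etrans (hom_on1 Tsg (hom1 psi')) (esym (hom_on1 Tsg (hom1 psi))).
    + apply: etrans (hom_onV Tsg (hom1 psi') I) _.
      exact: etrans (congr1 (fun k => k^-1) e) (esym (hom_onV Tsg (hom1 psi) I)).
    + apply: etrans (hom1 psi' y z I I) _.
      exact: etrans (f_equal2 (fun k l => k * l) ey ez) (esym (hom1 psi y z I I)).
  by move=> y Xy; apply: etrans (psi'X y Xy) (esym (psiX y Xy)).
- apply/seteqP; split=> [_ [n _ [x Xx <-]]|y Yy].
    have [g _ e] := XY _ Xx; exists (val n * g) => //.
    rewrite (_ : val _ = val n * v x * (val n)^-1) // e.
    by rewrite invgM !mulgA.
  have [g [Ng Xg]] := XC _ Yy; have [n en] := subgroup_sub (H := N) Ng.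
  exists n^-1 => //; exists (n * y * n^-1); first by move: Xg; rewrite -en.
  by rewrite /lconjg invgK !mulgA mulVg mul1g mulgVK.
Qed.

Theorem mainTheorem1 (F : groupType) (F_li : locally_indicable F)
    (T : action_tree F) (T_free : trivial_edge_stabilizers T)
    (r : F) (r_fix : forall v : vertex T, vertex_act r v <> v) :
  infinite_cyclic (centralizer r) /\ Cohen_Lyndon_aspherical r.
Proof.
have actP := @vertex_actP _ T.
have Tb := gadj_bridged (tree_is_tree T); have Tc := gadj_conn (tree_is_tree T).
have Tadj := @vertex_act_adj F T; have Tfree := vertex_act_free T_free.
have Tnoinv := @vertex_act_noinv F T.
have [[v1] _] := tree_is_tree T.
have [v0 ax] := on_axis_exists actP Tb Tc Tadj Tnoinv v1 r_fix.
(* With the empty relation, [sep_exists] yields an edge separating [v0] from its image, as [r] moves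
   [v0]. *)
have [//||a [b [ab _ _ sab]]] :=
    @sep_exists _ _ Tb (fun _ _ => False) _ v0 (vertex_act r v0) (Tc _ _).
  have none x : conn (fun _ _ => False) v0 x -> x = v0 by case=> // y z _ [].
  by move=> /none; apply: r_fix.
have inf := axis_inf actP Tb Tc Tadj ax ab sab.
split; last first.
  apply: Whitehead_of_Wh.
  have [s sP] := finite_esep actP Tc Tadj Tfree Tnoinv ab v0 (vertex_act r v0).
  have Hsg : is_subgroup [set: F] by [].
  have [] := @relator_tree F _ _ _ actP Tb Tc Tadj Tfree Tnoinv F_li
    (size s).+1 setT r v0 a b Hsg I ax ab sab; last by [].
  by exists s; split=> // f _; apply: sP.
have [t Ct tC] := centralizer_cyclic actP Tb Tc Tadj Tfree Tnoinv F_li ax ab sab.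
have CE f : subgroup_set (centralizer r) f <-> commute r f.
  rewrite /= /lconjg; split=> [e|c]; last by rewrite -c mulgK.
  by rewrite /commute -{1}e mulgVK.
split.
  have rX n : subgroup_set (centralizer r) (r ^+ n).
    by apply/CE; apply/commuteX/commute_refl.
  have /choice[h hP] n : exists x : centralizer r, val x = r ^+ n.
    exact: subgroup_sub.
  move=> fin; apply: infinite_nat.
  have -> : [set: nat] = h @^-1` [set: centralizer r] by [].
  apply: finite_preimage fin => i j _ _ e.
  by apply: (expg_eq_inf inf); rewrite -!hP e.
have [x ex] := subgroup_sub ((CE t).2 Ct).
exists x; apply/seteqP; split=> // y _.
have Ht : [set t] `<=` subgroup_set (centralizer r) by move=> _ ->; apply/CE.
have gy : generated [set t] (val y) by apply: tC; apply/CE; apply: val_subgroup.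
apply: generatedS (generated_val Ht gy) => z e.
by apply: val_inj; rewrite ex.
Qed.
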